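(* Let $d=2$, let $n_1,n_2\ge1$ be integers with $n=n_1n_2$, let $\mathbf x_1,\dots,\mathbf x_n$ be an enumeration of the lattice design $\mathbb L_{n_1,n_2}$, and let $\sigma>0$. Fix $f^*:[0,1]^2\to\mathbb R$, let $y_i=f^*(\mathbf x_i)+\xi_i$ with $\xi_1,\dots,\xi_n$ i.i.d. $N(0,\sigma^2)$, and consider the estimator $$\hat f_{\mathrm{HK}\mathbf 0,V}\in\operatorname*{arg\,min}_{f:\,V_{\mathrm{HK}\mathbf 0}(f)\le V}\frac1n\sum_{i=1}^n (y_i-f(\mathbf x_i))^2$$ with tuning parameter $V>0$. Then for every $0<c\le1/2$, $$\mathcal R(\hat f_{\mathrm{HK}\mathbf 0,V},f^* )\le\inf_{\substack{f\in\tilde{\mathfrak R}^2_1(c):\\ V_{\mathrm{HK}\mathbf 0}(f)=V}}\left\{\mathcal L(f,f^* )+C(c)\frac{\sigma^2}{n}(\log(en))^{3}(\log(e\log(en)))^{\frac32}\right\}$$ for a constant $C(c)$ that depends only on $c$.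
   Context: Notation: $\mathbf 1=(1,1)$; for $\mathbf a,\mathbf b\in[0,1]^2$ with $a_j\le b_j$ ($j=1,2$), $[\mathbf a,\mathbf b]=[a_1,b_1]\times[a_2,b_2]$. $\mathbb I_A$ is the indicator function of $A$. HK$\mathbf 0$ variation for $d=2$: for $f:[0,1]^2\to\mathbb R$, $$V_{\mathrm{HK}\mathbf 0}(f)=\mathrm{TV}(x\mapsto f(x,0))+\mathrm{TV}(x\mapsto f(0,x))+\sup\sum_{0\le l_1<k_1,\,0\le l_2<k_2}\left|f(x^{(1)}_{l_1+1},x^{(2)}_{l_2+1})-f(x^{(1)}_{l_1},x^{(2)}_{l_2+1})-f(x^{(1)}_{l_1+1},x^{(2)}_{l_2})+f(x^{(1)}_{l_1},x^{(2)}_{l_2})\right|,$$ where $\mathrm{TV}$ is the usual total variation of a function on $[0,1]$ and the supremum is over all pairs of partitions $0=x^{(s)}_0<\dots<x^{(s)}_{k_s}=1$, $s=1,2$. Lattice design: $\mathbb L_{n_1,n_2}=\{(i_1/n_1,i_2/n_2):0\le i_j\le n_j-1,\ j=1,2\}$. The class $\tilde{\mathfrak R}_1^2(c)$: all $f:[0,1]^2\to\mathbb R$ of the form $f=a_1\mathbb I_{[\mathbf x^*,\mathbf 1]}+a_0$ with $a_1,a_0\in\mathbb R$ and $\mathbf x^*\in[0,1]^2$ satisfying $\min\{|\mathbb L_{n_1,n_2}\cap[\mathbf x^*,\mathbf 1]|,\ |\mathbb L_{n_1,n_2}\setminus[\mathbf x^*,\mathbf 1]|\}\ge cn$. Loss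 and risk: $\mathcal L(g,f^* )=\frac1n\sum_{i=1}^n(g(\mathbf x_i)-f^*(\mathbf x_i))^2$ and $\mathcal R(\hat f,f^* )=\mathbb E\,\mathcal L(\hat f,f^* )$. The values of the estimator at the design points do not depend on the choice of minimizer. An infimum over the empty set is $+\infty$. *)

(* Defs.v *)
From HB Require Import structures.
From mathcomp Require Import all_boot all_order all_algebra finmap.
From mathcomp Require Import all_classical all_reals all_analysis.

Set Implicit Arguments.
Unset Strict Implicit.
Unset Printing Implicit Defensive.
Import Order.TTheory GRing.Theory Num.Theory.
Import numFieldNormedType.Exports.
Local Open Scope classical_set_scope.
Local Open Scope ring_scope.

(* Functions on [0,1]^2 are represented by total functions R * R -> R; every
   definition below depends only on their values on [0,1]^2. *)

Definition box {R : realType} (a b : R * R) : set (R * R) :=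
  `[a.1, b.1] `*` `[a.2, b.2].

(* As in the library's [variation], a partition 0 = x_0 < ... < x_k = 1 is the
   list [x_1; ...; x_k], so that x_l is the l-th item of 0 :: s. *)
Definition vitali_sum {R : realType} (f : R * R -> R) (s1 s2 : seq R) : R :=
  let x l := nth 1 (0 :: s1) l in
  let y l := nth 1 (0 :: s2) l in
  \sum_(l1 < size s1) \sum_(l2 < size s2)
    `| f (x l1.+1, y l2.+1) - f (x l1, y l2.+1)
       - f (x l1.+1, y l2) + f (x l1, y l2) |.

Definition vitali_variation {R : realType} (f : R * R -> R) : \bar R :=
  ereal_sup [set (vitali_sum f s.1 s.2)%:E | s in
    [set s : seq R * seq R | itv_partition 0 1 s.1 /\ itv_partition 0 1 s.2]].

Definition hk0_variation {R : realType} (f : R * R -> R) : \bar R :=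
  (total_variation 0%R 1%R (fun t : R => f (t, 0%R)) +
   total_variation 0%R 1%R (fun t : R => f (0%R, t)) +
   vitali_variation f)%E.

Definition lattice {R : realType} (n1 n2 : nat) : set (R * R) :=
  [set p | exists i1 i2 : nat, [/\ (i1 < n1)%N, (i2 < n2)%N &
    p = (i1%:R / n1%:R, i2%:R / n2%:R)]].

(* [fset_set A] is empty when A is infinite; it is only used on subsets of the
   (finite) lattice. *)
Definition one_jump {R : realType} (n1 n2 : nat) (c : R) :
    set (R * R -> R) :=
  [set f | exists (a1 a0 : R) (xs : R * R),
    [/\ box (0, 0) (1, 1) xs,
        c * (n1 * n2)%:R <=
          (minn #|` fset_set (lattice n1 n2 `&` box xs (1, 1))|
                #|` fset_set (lattice n1 n2 `\` box xs (1, 1))|)%:R &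
        forall p, box (0, 0) (1, 1) p ->
          f p = a1 * \1_(box xs (1, 1)) p + a0]].

Definition loss {R : realType} (n : nat) (x : 'I_n -> R * R)
    (g f : R * R -> R) : R :=
  n%:R^-1 * \sum_(i < n) (g (x i) - f (x i)) ^+ 2.

Definition empirical_risk {R : realType} (n : nat) (x : 'I_n -> R * R)
    (y : 'I_n -> R) (f : R * R -> R) : R :=
  n%:R^-1 * \sum_(i < n) (y i - f (x i)) ^+ 2.

Definition hk0_lse {R : realType} (n : nat) (x : 'I_n -> R * R)
    (y : 'I_n -> R) (V : R) : set (R * R -> R) :=
  [set f | (hk0_variation f <= V%:E)%E /\
    forall g : R * R -> R, (hk0_variation g <= V%:E)%E ->
      empirical_risk x y f <= empirical_risk x y g].

Definition mutually_independent {d : measure_display} {T : measurableType d}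
    {R : realType} (P : probability T R) {I : finType}
    (X : I -> {RV P >-> R}) : Prop :=
  forall (J : {set I}) (A : I -> set R),
    (forall i, measurable (A i)) ->
    P (\bigcap_(i in [set j | j \in J]) X i @^-1` A i) =
    (\prod_(i in J) P (X i @^-1` A i))%E.

(* The parameter sigma of [normal_prob] is the standard deviation. *)
Definition iid_normal {d : measure_display} {T : measurableType d}
    {R : realType} (P : probability T R) {I : finType} (sigma : R)
    (X : I -> {RV P >-> R}) : Prop :=
  mutually_independent X /\
  forall i (A : set R), measurable A ->
    distribution P (X i) A = normal_prob 0 sigma A.

(* (log (e n))^3 (log (e log (e n)))^(3/2) *)
Definition log_factor {R : realType} (n : nat) : R :=
  let e := expR 1 in
  ln (e * n%:R) ^+ 3 * ln (e * ln (e * n%:R)) `^ (3 / 2).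

(* Main.v *)
Require Import Defs.
From HB Require Import structures.
From mathcomp Require Import all_boot all_order all_algebra finmap.
From mathcomp Require Import all_classical all_reals all_analysis.
From mathcomp Require Import measurable_realfun.
From mathcomp Require Import lra ring zify.

Set Implicit Arguments.
Unset Strict Implicit.
Unset Printing Implicit Defensive.
Import Order.TTheory GRing.Theory Num.Theory.
Import numFieldNormedType.Exports.
Local Open Scope classical_set_scope.
Local Open Scope ring_scope.

(* Let f be the one-jump function, with corner k on the grid, and u = fhat - f
   on the grid.  Convexity of the constraint gives
     |fhat - f*|^2 <= |f - f*|^2 + 2 <xi, u> - |u|^2.
   Take a_1 > 0.  The mixed differences of fhat off the origin have total mass
   at most V <= a_1, so u = b + sum_j gam_j 1_{>= j} - g 1_{>= k} with
   sum |gam_j| <= g = a_1.  Up to exchanging the two coordinates, some row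
   above the height of the corner contains points on both sides of the jump
   where |u| is O(|u|_2 / sqrt n), which forces
   g - sum gam_j^+ and sum gam_j^- to be O(|u|_2 / sqrt n).  Up to errors of that
   size u is v = sum_j gam_j^+ (1_{>= j} - 1_{>= k}), whose summands are all
   nonnegative off the jump quadrant and all nonpositive on it.
   Each 1_{>= j} - 1_{>= k} is a signed sum of four disjoint rectangles.  With
   high probability the noise on a rectangle is at most
   sigma sqrt(log n) sqrt(area), and sqrt(area) is the sum over the rectangle of
   product weights w whose squares sum to O(log^2 n).  Since the summands of v
   do not cancel, <xi, v> <= sigma sqrt(log n) <w, |v|> and Cauchy-Schwarz gives
   2 <xi, u> - |u|^2 = O(sigma^2 log^3 n), with no chaining. *)

(** * Product weights on the grid *)

Section root_weights.
Variable R : realType.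
Implicit Types (a b i n : nat).

Definition rootn n : R := Num.sqrt n%:R.

Lemma rootn0 : rootn 0 = 0. Proof. by rewrite /rootn mulr0n sqrtr0. Qed.

Lemma rootn_ge0 n : 0 <= rootn n. Proof. exact: sqrtr_ge0. Qed.

(** Increments of the square root of the distance to a fixed end, the left end [a] here and the
    right end [b] in [weight_down]. Truncated subtraction makes them vanish beyond that end, so one
    weight serves every interval that starts at [a], respectively ends at [b]. *)
Definition weight_up a i : R := rootn (i.+1 - a) - rootn (i - a).
Definition weight_down b i : R := rootn (b - i) - rootn (b - i.+1).

Lemma sum_weight_up a b : \sum_(a <= i < b) weight_up a i = rootn (b - a).
Proof.
have [ab|ba] := leqP a b; last first.
  rewrite big_geq; last exact: ltnW.
  by rewrite (eqP (ltnW ba : b - a == 0)%N) rootn0.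
by rewrite telescope_sumr// subnn rootn0 subr0.
Qed.

Lemma sum_weight_down a b : \sum_(a <= i < b) weight_down b i = rootn (b - a).
Proof.
have [ab|ba] := leqP a b; last first.
  rewrite big_geq; last exact: ltnW.
  by rewrite (eqP (ltnW ba : b - a == 0)%N) rootn0.
under eq_bigr do rewrite /weight_down -opprB.
by rewrite sumrN (telescope_sumr (fun i => rootn (b - i)))// subnn rootn0 sub0r opprK.
Qed.

(** The difference of the two roots times their sum is 1, so the difference is at most the inverse
    of the larger root. *)
Lemma rootnS_sub_sqr n : (rootn n.+1 - rootn n) ^+ 2 <= n.+1%:R^-1.
Proof.
have h0 : 0 < rootn n.+1 by rewrite sqrtr_gt0 ltr0n.
have hn := rootn_ge0 n.
have e1 : rootn n.+1 ^+ 2 = n.+1%:R by rewrite sqr_sqrtr ?ler0n.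
have e2 : rootn n ^+ 2 = n%:R by rewrite sqr_sqrtr ?ler0n.
have le : rootn n <= rootn n.+1 by rewrite ler_sqrt ?ler0n ?ler_nat.
rewrite -e1 -exprVn lerXn2r ?nnegrE ?invr_ge0 ?subr_ge0 ?(ltW h0)//.
rewrite -[X in _ <= X]mul1r ler_pdivlMr//.
have : rootn n.+1 ^+ 2 - rootn n ^+ 2 = 1 by rewrite e1 e2 -natr1; ring.
nra.
Qed.

Lemma harmonic_le_ln n : (0 < n)%N ->
  \sum_(0 <= i < n) i.+1%:R^-1 <= 1 + ln n%:R :> R.
Proof.
case: n => // n _; elim: n => [|n ih].
  by rewrite big_nat1 invr1 ln1 addr0.
rewrite big_nat_recr//=; apply: le_trans (lerD ih (lexx _)) _.
rewrite -addrA lerD2l.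
have n1 : (0:R) < n.+1%:R by rewrite ltr0n.
have n2 : (0:R) < n.+2%:R by rewrite ltr0n.
(* The inequality ln (1 + x) <= x at x = - 1 / (n + 2). *)
have : ln (n.+1%:R / n.+2%:R) <= n.+1%:R / n.+2%:R - 1 :> R.
  have := @le_ln1Dx R (n.+1%:R / n.+2%:R - 1).
  have -> : 1 + (n.+1%:R / n.+2%:R - 1) = n.+1%:R / n.+2%:R :> R by ring.
  by apply; rewrite ltrBDr addNr divr_gt0.
rewrite ln_div ?posrE//.
have -> : n.+1%:R / n.+2%:R - 1 = - n.+2%:R^-1 :> R.
  rewrite -[n.+2%:R]natr1; move: n.+1%:R n1 => a a0.
  by field; rewrite gt_eqF// ltr_wpDr.
by rewrite lerBlDr (addrC (- _)) => h; rewrite -lerBrDr.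
Qed.

(** By [rootnS_sub_sqr] the squares are dominated by the harmonic series, so the weights cost a
    logarithm and not a power of [n]. *)
Lemma sum_weight_up_sqr a n : (0 < n)%N ->
  \sum_(i < n) weight_up a i ^+ 2 <= 1 + ln n%:R.
Proof.
move=> n0; apply: le_trans (harmonic_le_ln n0).
rewrite -(big_mkord xpredT (fun i => weight_up a i ^+ 2)).
have [an|na] := leqP n a.
  rewrite big_nat big1 ?sumr_ge0// => i /andP[_ iN].
  rewrite /weight_up; have -> : (i.+1 - a = 0)%N by lia.
  have -> : (i - a = 0)%N by lia.
  by rewrite subrr expr2 mul0r.
rewrite (big_cat_nat _ (n := a))//=; last exact: ltnW.
rewrite big_nat big1 ?add0r; last first.
  move=> i /andP[_ iN].
  rewrite /weight_up; have -> : (i.+1 - a = 0)%N by lia.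
  have -> : (i - a = 0)%N by lia.
  by rewrite subrr expr2 mul0r.
rewrite -{1}[a]add0n big_addn.
rewrite [leRHS](big_cat_nat _ (n := (n - a)%N))//= ?leq_subr//.
rewrite -[leLHS]addr0 lerD ?sumr_ge0//.
apply: ler_sum => i _; rewrite /weight_up addnK.
have -> : ((i + a).+1 - a = i.+1)%N by lia.
exact: rootnS_sub_sqr.
Qed.

Lemma sum_weight_down_sqr b n : (0 < n)%N -> (b <= n)%N ->
  \sum_(i < n) weight_down b i ^+ 2 <= 1 + ln n%:R.
Proof.
move=> n0 bn; apply: le_trans (harmonic_le_ln n0).
rewrite -(big_mkord xpredT (fun i => weight_down b i ^+ 2)).
rewrite (big_cat_nat _ (n := b))//= [X in _ + X]big_nat.
rewrite [X in _ + X]big1 ?addr0; last first.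
  move=> i /andP[iN _].
  rewrite /weight_down; have -> : (b - i.+1 = 0)%N by lia.
  have -> : (b - i = 0)%N by lia.
  by rewrite subrr expr2 mul0r.
rewrite [leRHS](big_cat_nat _ (n := b))//=.
rewrite -[leLHS]addr0 lerD ?sumr_ge0//.
(* Reversing the summation makes the index the distance to [b]. *)
rewrite big_nat_rev/= !big_nat; apply: ler_sum => i /andP[_ ib]; rewrite /weight_down.
have -> : (b - (0 + b - i.+1) = i.+1)%N by lia.
have -> : (b - (0 + b - i.+1).+1 = i)%N by lia.
exact: rootnS_sub_sqr.
Qed.

End root_weights.

Section grid.
Variable R : realType.
Variables n1 n2 : nat.
Local Notation G := ('I_n1 * 'I_n2)%type.

Definition in_rect (a1 b1 a2 b2 : nat) (i : G) : bool :=
  (a1 <= i.1 < b1)%N && (a2 <= i.2 < b2)%N.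

Lemma sum_ord_between n (a b : nat) (F : nat -> R) : (b <= n)%N ->
  \sum_(i < n) F i * (a <= i < b)%N%:R = \sum_(a <= i < b) F i.
Proof.
move=> bn.
transitivity (\sum_(i < n | (a <= i < b)%N) F i).
  rewrite [RHS]big_mkcond/=; apply: eq_bigr => i _.
  by case: ifP; rewrite ?mulr1 ?mulr0.
rewrite -(big_mkord (fun i => (a <= i < b)%N) F).
rewrite (big_nat_widen _ _ _ _ _ bn) [RHS](big_nat_widenl _ 0)//.
by apply: eq_bigl => i /=; rewrite andbC.
Qed.

(** With unit weights this counts cells, which is how cardinalities are obtained later. *)
Lemma sum_rect (w1 w2 : nat -> R) (a1 b1 a2 b2 : nat) :
  (b1 <= n1)%N -> (b2 <= n2)%N ->
  \sum_(i : G) w1 i.1 * w2 i.2 * (in_rect a1 b1 a2 b2 i)%:R =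
  (\sum_(a1 <= i < b1) w1 i) * (\sum_(a2 <= i < b2) w2 i).
Proof.
move=> h1 h2; rewrite -(sum_ord_between _ _ h1) -(sum_ord_between _ _ h2).
rewrite big_distrlr pair_bigA/=; apply: eq_bigr => i _.
by rewrite /in_rect -mulnb natrM; ring.
Qed.

Lemma sum_prod_sqr (w1 w2 : nat -> R) :
  \sum_(i : G) (w1 i.1 * w2 i.2) ^+ 2 =
  (\sum_(i < n1) w1 i ^+ 2) * (\sum_(i < n2) w2 i ^+ 2).
Proof.
rewrite big_distrlr pair_bigA/=; apply: eq_bigr => i _.
by rewrite exprMn.
Qed.

Definition grid_le (j1 j2 : nat) (i : G) : bool := (j1 <= i.1)%N && (j2 <= i.2)%N.

(* Here and below an interval [a, b) of naturals with b <= a is empty, so that the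
   four rectangles need no case distinction on the position of j. *)
Lemma grid_le_sub (k1 k2 j1 j2 : nat) (i : G) :
  (grid_le j1 j2 i)%:R - (grid_le k1 k2 i)%:R =
    (in_rect j1 k1 j2 n2 i)%:R + (in_rect (maxn j1 k1) n1 j2 k2 i)%:R
    - (in_rect k1 j1 k2 n2 i)%:R - (in_rect (maxn j1 k1) n1 k2 j2 i)%:R :> R.
Proof.
rewrite /grid_le /in_rect geq_max; case: i => i1 i2 /=; rewrite !ltn_ord !andbT.
case: (leqP j1 i1); case: (leqP j2 i2); case: (leqP k1 i1); case: (leqP k2 i2);
  move=> /= *; ring.
Qed.

(** The four rectangles are pairwise disjoint, so the absolute value only makes every sign
    positive. *)
Lemma grid_le_sub_norm (k1 k2 j1 j2 : nat) (i : G) :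
  `|(grid_le j1 j2 i)%:R - (grid_le k1 k2 i)%:R| =
    (in_rect j1 k1 j2 n2 i)%:R + (in_rect (maxn j1 k1) n1 j2 k2 i)%:R
    + (in_rect k1 j1 k2 n2 i)%:R + (in_rect (maxn j1 k1) n1 k2 j2 i)%:R :> R.
Proof.
rewrite /grid_le /in_rect geq_max; case: i => i1 i2 /=; rewrite !ltn_ord !andbT.
case: (leqP j1 i1); case: (leqP j2 i2); case: (leqP k1 i1); case: (leqP k2 i2);
  move=> /= *; rewrite ?subrr ?subr0 ?sub0r ?normr0 ?normrN ?normr1; ring.
Qed.

End grid.

(** * Noise along the tangent cone *)

Section row_gap.
Variable R : realType.

Lemma ler_sum_between n a b (e : R) (F : nat -> R) : (b <= n)%N ->
  (forall i, 0 <= F i) -> (forall i, (a <= i < b)%N -> e <= F i) ->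
  (b - a)%:R * e <= \sum_(i < n) F i.
Proof.
move=> bn F0 eF.
apply: (@le_trans _ _ (\sum_(a <= i < b) F i)).
  rewrite mulr_natl -sumr_const_nat !big_nat.
  by apply: ler_sum => i /eF.
rewrite -(sum_ord_between a F bn); apply: ler_sum => i _.
by rewrite ler_piMr// lern1 leq_b1.
Qed.

(** On a row [s] past [k2], either all [k1] cells before the jump have |u| >= de / 2, or one of them
    fails and then all [n1 - k1] cells past the jump satisfy it. Each such row thus contributes at
    least c n1 de^2 / 4. *)
Lemma row_gap n1 n2 k1 k2 (u : nat -> nat -> R) (de c : R) :
  0 <= c -> 0 <= de -> (k1 <= n1)%N -> (k2 <= n2)%N ->
  c * n1%:R <= k1%:R -> c * n1%:R <= (n1 - k1)%:R -> c * n2%:R <= (n2 - k2)%:R ->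
  (forall i1 p1 s, (i1 < k1)%N -> (k1 <= p1 < n1)%N -> (k2 <= s < n2)%N ->
     de <= `|u p1 s| + `|u i1 s|) ->
  c * n1%:R * (c * n2%:R) * de ^+ 2 <=
  4 * \sum_(i : 'I_n1 * 'I_n2) u i.1 i.2 ^+ 2.
Proof.
move=> c0 de0 kn1 kn2 h1 h2 h3 hu.
have cn1 : 0 <= c * n1%:R by rewrite mulr_ge0.
have cn2 : 0 <= c * n2%:R by rewrite mulr_ge0.
have sq_half x : de / 2 <= `|x| -> de ^+ 2 / 4 <= x ^+ 2.
  move=> h; rewrite -(real_normK (num_real x)).
  by have := normr_ge0 x; nra.
have row s : (k2 <= s < n2)%N ->
    c * n1%:R * (de ^+ 2 / 4) <= \sum_(i < n1) u i s ^+ 2.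
  move=> hs.
  have de4 : 0 <= de ^+ 2 / 4 by rewrite mulr_ge0 ?sqr_ge0.
  have [/forallP all|] := boolP [forall i : 'I_k1, de / 2 <= `|u i s|].
    apply: (@le_trans _ _ ((k1 - 0)%:R * (de ^+ 2 / 4))).
      by rewrite subn0 ler_wpM2r.
    apply: (@ler_sum_between _ _ _ _ (fun i => u i s ^+ 2)) => // [i|i /= ik].
      exact: sqr_ge0.
    exact: sq_half (all (Ordinal ik)).
  rewrite negb_forall => /existsP[i]; rewrite -ltNge => ui.
  apply: (@le_trans _ _ ((n1 - k1)%:R * (de ^+ 2 / 4))); first by rewrite ler_wpM2r.
  apply: (@ler_sum_between _ _ _ _ (fun i => u i s ^+ 2)) => // [p|p /= hp].
    exact: sqr_ge0.
  apply: sq_half; have := hu i p s (ltn_ord i) hp hs.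
  lra.
rewrite -(pair_bigA _ (fun i j => u (nat_of_ord i) (nat_of_ord j) ^+ 2))/= exchange_big/=.
apply: (@le_trans _ _ (4 * ((n2 - k2)%:R * (c * n1%:R * (de ^+ 2 / 4))))).
  rewrite (_ : _ * de ^+ 2 = 4 * (c * n2%:R * (c * n1%:R * (de ^+ 2 / 4)))); last by field.
  by rewrite ler_pM2l// ler_wpM2r// mulr_ge0// mulr_ge0 ?sqr_ge0.
rewrite ler_pM2l//.
apply: (@ler_sum_between _ _ _ _ (fun s => \sum_(i < n1) u i s ^+ 2)) => //.
by move=> s; apply: sumr_ge0 => i _; exact: sqr_ge0.
Qed.

End row_gap.

Section tangent_noise.
Variable R : realType.
Variables n1 n2 k1 k2 : nat.
Local Notation G := ('I_n1 * 'I_n2)%type.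
Variables (Q L : R).
Hypothesis n1_gt0 : (0 < n1)%N.
Hypothesis n2_gt0 : (0 < n2)%N.
Hypothesis Q_ge0 : 0 <= Q.
Hypothesis L1 : 1 + ln n1%:R <= L.
Hypothesis L2 : 1 + ln n2%:R <= L.
Variable z : G -> R.
Hypothesis z_rect : forall a1 b1 a2 b2, (b1 <= n1)%N -> (b2 <= n2)%N ->
  `|\sum_i z i * (in_rect a1 b1 a2 b2 i)%:R| <=
  Q * (rootn R (b1 - a1) * rootn R (b2 - a2)).

Lemma rootn_le m n : (m <= n)%N -> rootn R m <= rootn R n.
Proof. by move=> mn; rewrite ler_sqrt ?ler0n ?ler_nat. Qed.

Lemma weight_up_ge0 a i : 0 <= weight_up R a i.
Proof. by rewrite subr_ge0 rootn_le//; lia. Qed.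

Lemma weight_down_ge0 b i : 0 <= weight_down R b i.
Proof. by rewrite subr_ge0 rootn_le//; lia. Qed.

(** One product weight for each rectangle of [grid_le_sub], anchored in each coordinate at the end
    that does not move with [j]. Hence a single weight works for all [j]. *)
Definition corner_weight (i : G) : R :=
  weight_down R k1 i.1 * weight_down R n2 i.2 +
  weight_down R n1 i.1 * weight_down R k2 i.2 +
  weight_up R k1 i.1 * weight_down R n2 i.2 +
  weight_down R n1 i.1 * weight_up R k2 i.2.

Hypothesis k1n : (k1 <= n1)%N.
Hypothesis k2n : (k2 <= n2)%N.

Lemma ln_nat_ge0 n : (0 < n)%N -> 0 <= ln n%:R :> R.
Proof. by move=> n0; rewrite ln_ge0// ler1n. Qed.

Lemma L_ge1 : 1 <= L.
Proof. by apply: le_trans L1; rewrite lerDl ln_nat_ge0. Qed.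

Lemma sum_corner_weight_sqr : \sum_i corner_weight i ^+ 2 <= 16 * L ^+ 2.
Proof.
have L0 := L_ge1.
have prodL (w1 w2 : nat -> R) : \sum_(i < n1) w1 i ^+ 2 <= 1 + ln n1%:R ->
    \sum_(i < n2) w2 i ^+ 2 <= 1 + ln n2%:R ->
    \sum_(i : G) (w1 i.1 * w2 i.2) ^+ 2 <= L ^+ 2.
  move=> h1 h2; rewrite sum_prod_sqr expr2.
  by rewrite ler_pM ?sumr_ge0//; [move=> *; exact: sqr_ge0|move=> *; exact: sqr_ge0|
    exact: le_trans L1|exact: le_trans L2].
pose s4 (i : G) := (weight_down R k1 i.1 * weight_down R n2 i.2) ^+ 2 +
  (weight_down R n1 i.1 * weight_down R k2 i.2) ^+ 2 +
  (weight_up R k1 i.1 * weight_down R n2 i.2) ^+ 2 +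
  (weight_down R n1 i.1 * weight_up R k2 i.2) ^+ 2.
apply: (@le_trans _ _ (\sum_i 4 * s4 i)).
  apply: ler_sum => i _; rewrite /corner_weight /s4.
  move: (_ * weight_down R n2 i.2) (_ * weight_down R k2 i.2) (weight_up R k1 _ * _)
    (_ * weight_up R k2 _) => p q r s.
  (* Cauchy-Schwarz for four terms: the square of the sum is at most 4 times the sum of the
     squares. *)
  have := sqr_ge0 (p - q); have := sqr_ge0 (p - r); have := sqr_ge0 (p - s).
  have := sqr_ge0 (q - r); have := sqr_ge0 (q - s); have := sqr_ge0 (r - s).
  lra.
rewrite -mulr_sumr /s4 !big_split/=.
have h1 : \sum_(i : G) (weight_down R k1 i.1 * weight_down R n2 i.2) ^+ 2 <= L ^+ 2.
  by apply: prodL; apply: sum_weight_down_sqr.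
have h2 : \sum_(i : G) (weight_down R n1 i.1 * weight_down R k2 i.2) ^+ 2 <= L ^+ 2.
  by apply: prodL; apply: sum_weight_down_sqr.
have h3 : \sum_(i : G) (weight_up R k1 i.1 * weight_down R n2 i.2) ^+ 2 <= L ^+ 2.
  by apply: prodL; [apply: sum_weight_up_sqr|apply: sum_weight_down_sqr].
have h4 : \sum_(i : G) (weight_down R n1 i.1 * weight_up R k2 i.2) ^+ 2 <= L ^+ 2.
  by apply: prodL; [apply: sum_weight_down_sqr|apply: sum_weight_up_sqr].
lra.
Qed.

Definition quadrant_diff (j i : G) : R :=
  (grid_le j.1 j.2 i)%:R - (grid_le k1 k2 i)%:R.

(** The root of the area is the sum of the product weight over the rectangle; written as a sum over
    cells, the bounds of several rectangles can be added. *)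
Lemma noise_rect a1 b1 a2 b2 (w1 w2 : nat -> R) :
  (b1 <= n1)%N -> (b2 <= n2)%N ->
  \sum_(a1 <= i < b1) w1 i = rootn R (b1 - a1) ->
  \sum_(a2 <= i < b2) w2 i = rootn R (b2 - a2) ->
  (forall i : G, w1 i.1 * w2 i.2 <= corner_weight i) ->
  `|\sum_i z i * (in_rect a1 b1 a2 b2 i)%:R| <=
  Q * \sum_i corner_weight i * (in_rect a1 b1 a2 b2 i)%:R.
Proof.
move=> bn1 bn2 e1 e2 wle; apply: le_trans (z_rect a1 a2 bn1 bn2) _.
rewrite ler_wpM2l// -e1 -e2 -(@sum_rect _ n1 n2)//.
by apply: ler_sum => i _; rewrite ler_wpM2r.
Qed.

(** The triangle inequality is applied to the four rectangles; by disjointness their weights add up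
    to exactly the right-hand side. *)
Lemma noise_quadrant_diff (j : G) :
  `|\sum_i z i * quadrant_diff j i| <=
  Q * \sum_i corner_weight i * `|quadrant_diff j i|.
Proof.
have j1n : (j.1 <= n1)%N by rewrite ltnW.
have j2n : (j.2 <= n2)%N by rewrite ltnW.
under eq_bigr do rewrite /quadrant_diff grid_le_sub mulrBr mulrBr mulrDr.
under [X in _ <= Q * X]eq_bigr do
  rewrite /quadrant_diff grid_le_sub_norm mulrDr mulrDr mulrDr.
rewrite !sumrB !big_split/= !mulrDr.
have w4 (p q r s : R) : 0 <= p -> 0 <= q -> 0 <= r -> 0 <= s ->
  [/\ p <= p + q + r + s, q <= p + q + r + s, r <= p + q + r + s &
      s <= p + q + r + s] by move=> *; split; lra.
have wle (i : G) := w4 _ _ _ _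
  (mulr_ge0 (weight_down_ge0 k1 i.1) (weight_down_ge0 n2 i.2))
  (mulr_ge0 (weight_down_ge0 n1 i.1) (weight_down_ge0 k2 i.2))
  (mulr_ge0 (weight_up_ge0 k1 i.1) (weight_down_ge0 n2 i.2))
  (mulr_ge0 (weight_down_ge0 n1 i.1) (weight_up_ge0 k2 i.2)).
have h1 := noise_rect k1n (leqnn n2) (sum_weight_down R j.1 k1)
  (sum_weight_down R j.2 n2)
  (fun i => let: And4 h _ _ _ := wle i in h).
have h2 := noise_rect (leqnn n1) k2n (sum_weight_down R (maxn j.1 k1) n1)
  (sum_weight_down R j.2 k2)
  (fun i => let: And4 _ h _ _ := wle i in h).
have h3 := noise_rect j1n (leqnn n2) (sum_weight_up R k1 j.1)
  (sum_weight_down R k2 n2)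
  (fun i => let: And4 _ _ h _ := wle i in h).
have h4 := noise_rect (leqnn n1) j2n (sum_weight_down R (maxn j.1 k1) n1)
  (sum_weight_up R k2 j.2)
  (fun i => let: And4 _ _ _ h := wle i in h).
apply: le_trans (ler_normB _ _) _; rewrite lerD//.
apply: le_trans (ler_normB _ _) _; rewrite lerD//.
by apply: le_trans (ler_normD _ _) _; rewrite lerD.
Qed.

(* [gam] stands for the mixed differences of the estimator off the origin and
   [g] for the height of the jump. *)
Variables (gam : G -> R) (g : R).
Hypothesis gam_le : \sum_j `|gam j| <= g.
Variable b : R.

(** Taking naturals as arguments lets [row_gap] be applied with the two coordinates exchanged. *)
Definition cone_fun (i1 i2 : nat) : R :=
  b + \sum_(j : G) gam j * ((j.1 <= i1)%N && (j.2 <= i2)%N)%:R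
  - g * ((k1 <= i1)%N && (k2 <= i2)%N)%:R.

Local Notation u i := (cone_fun (nat_of_ord i.1) (nat_of_ord i.2)).
Let p j := Num.max (gam j) 0.
Let m j := Num.max (- gam j) 0.
(** The part of the jump height that the positive mass leaves over. It also bounds the negative
    mass, because positive and negative mass together are at most [g], and so it controls the
    distance from [u] to [b + v]. *)
Let de := g - \sum_j p j.
Let v i := \sum_j p j * quadrant_diff j i.

Let p_ge0 j : 0 <= p j. Proof. by rewrite le_max lexx orbT. Qed.
Let m_ge0 j : 0 <= m j. Proof. by rewrite le_max lexx orbT. Qed.
Let gam_parts j : gam j = p j - m j /\ `|gam j| = p j + m j.
Proof.
rewrite /p /m; have [h|h] := leP (gam j) 0.
  rewrite max_l ?oppr_ge0// ler0_norm//; split; ring.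
have h' : - gam j <= 0 by rewrite oppr_le0 ltW.
by rewrite max_r// gtr0_norm//; split; ring.
Qed.

Let gamE j : gam j = p j - m j. Proof. exact: (gam_parts j).1. Qed.
Let gam_norm j : `|gam j| = p j + m j. Proof. exact: (gam_parts j).2. Qed.

Let m_le_de : \sum_j m j <= de.
Proof.
rewrite lerBrDr addrC; apply: le_trans gam_le.
by rewrite -big_split/=; apply: ler_sum => j _; rewrite gam_norm.
Qed.

Let de_ge0 : 0 <= de.
Proof. by apply: le_trans m_le_de; apply: sumr_ge0. Qed.

(** The jump [g] is split into [de] and the masses [p j], and each [p j] is paired with its own
    quadrant to form [v]. *)
Let uE (i : G) : u i = b + v i - de * (grid_le k1 k2 i)%:R
  - \sum_j m j * (grid_le j.1 j.2 i)%:R.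
Proof.
rewrite /cone_fun /v /quadrant_diff /de.
under [\sum_j p j * (_ - _)]eq_bigr do rewrite mulrBr.
rewrite sumrB -mulr_suml.
under eq_bigr do rewrite gamE mulrBl.
by rewrite sumrB /grid_le; ring.
Qed.

Let u_approx (i : G) : `|u i - (b + v i)| <= 2 * de.
Proof.
have h0 : 0 <= \sum_j m j * (grid_le j.1 j.2 i)%:R.
  by apply: sumr_ge0 => j _; rewrite mulr_ge0.
have h1 : \sum_j m j * (grid_le j.1 j.2 i)%:R <= de.
  apply: le_trans m_le_de; apply: ler_sum => j _.
  by rewrite ler_piMr// lern1 leq_b1.
have h2 : 0 <= de * (grid_le k1 k2 i)%:R <= de.
  by rewrite mulr_ge0//= ler_piMr// lern1 leq_b1.
rewrite uE ler_norml; lra.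
Qed.

(** All differences [quadrant_diff j i] have the same sign at a given [i]: nonpositive on the jump
    quadrant, nonnegative off it. So nothing cancels in [v]. *)
Let v_norm (i : G) : `|v i| = \sum_j p j * `|quadrant_diff j i|.
Proof.
rewrite /v; have [A|A] := boolP (grid_le k1 k2 i).
- have d0 j : quadrant_diff j i <= 0.
    by rewrite /quadrant_diff A subr_le0 lern1 leq_b1.
  rewrite ler0_norm; last by apply: sumr_le0 => j _; rewrite mulr_ge0_le0.
  by rewrite -sumrN; apply: eq_bigr => j _; rewrite ler0_norm// mulrN.
- have d0 j : 0 <= quadrant_diff j i.
    by rewrite /quadrant_diff (negbTE A) subr0.
  rewrite ger0_norm; last by apply: sumr_ge0 => j _; rewrite mulr_ge0.
  by apply: eq_bigr => j _; rewrite ger0_norm.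
Qed.

(** The bounds for single quadrants are summed with weights [p j], and [v_norm] reassembles the
    right-hand side into [|v i|] without loss. *)
Let noise_v : \sum_i z i * v i <= Q * \sum_i corner_weight i * `|v i|.
Proof.
apply: (@le_trans _ _ (\sum_j p j * \sum_i z i * quadrant_diff j i)).
  under eq_bigr do rewrite /v mulr_sumr.
  rewrite exchange_big/= le_eqVlt; apply/orP; left; apply/eqP.
  apply: eq_bigr => j _; rewrite mulr_sumr.
  by apply: eq_bigr => i _; rewrite mulrCA.
apply: (@le_trans _ _
    (\sum_j p j * (Q * \sum_i corner_weight i * `|quadrant_diff j i|))).
  apply: ler_sum => j _; rewrite ler_wpM2l//.
  exact: le_trans (ler_norm _) (noise_quadrant_diff j).
under [X in _ <= Q * X]eq_bigr do rewrite v_norm mulr_sumr.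
rewrite exchange_big/= mulr_sumr le_eqVlt; apply/orP; left; apply/eqP.
apply: eq_bigr => j _; rewrite mulrCA; congr (_ * _); rewrite mulr_sumr.
by apply: eq_bigr => i _; rewrite mulrCA.
Qed.

Let S (j1 j2 : nat) := \sum_i z i * (grid_le j1 j2 i)%:R.

Let S_le j1 j2 : `|S j1 j2| <= Q * (rootn R n1 * rootn R n2).
Proof.
have -> : S j1 j2 = \sum_i z i * (in_rect j1 n1 j2 n2 i)%:R.
  by apply: eq_bigr => i _; rewrite /in_rect /grid_le !ltn_ord !andbT.
apply: le_trans (z_rect _ _ (leqnn _) (leqnn _)) _.
by rewrite ler_wpM2l// ler_pM ?rootn_ge0// rootn_le// leq_subr.
Qed.

(** In the expansion [uE], the constant, the leftover jump and the negative part are handled by the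
    crude bound for the noise on a quadrant, with total coefficient at most |b| + 2 de. *)
Lemma noise_cone_fun :
  \sum_i z i * u i <=
  Q * (rootn R n1 * rootn R n2) * (`|b| + 2 * de) +
  Q * \sum_i corner_weight i * `|v i|.
Proof.
have -> : \sum_i z i * u i = b * S 0 0 + \sum_i z i * v i - de * S k1 k2
    - \sum_j m j * S j.1 j.2.
  under eq_bigr do rewrite uE !(mulrBr, mulrDr).
  rewrite !sumrB big_split/=; congr (_ + _ - _ - _).
  - rewrite /S mulr_sumr; apply: eq_bigr => i _.
    by rewrite /grid_le !leq0n mulr1 mulrC.
  - by rewrite /S mulr_sumr; apply: eq_bigr => i _; rewrite mulrCA.
  - under eq_bigr do rewrite mulr_sumr.
    rewrite exchange_big/=; apply: eq_bigr => j _; rewrite /S mulr_sumr.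
    by apply: eq_bigr => i _; rewrite mulrCA.
set M := Q * (_ * _).
have M0 : 0 <= M by rewrite mulr_ge0// mulr_ge0 ?rootn_ge0.
have h1 : b * S 0 0 <= M * `|b|.
  by apply: le_trans (ler_norm _) _; rewrite normrM mulrC ler_wpM2r ?S_le.
have h2 : - (de * S k1 k2) <= M * de.
  apply: le_trans (ler_norm _) _; rewrite normrN normrM mulrC.
  by rewrite (ger0_norm de_ge0) ler_wpM2r ?S_le.
have h3 : - (\sum_j m j * S j.1 j.2) <= M * de.
  rewrite -sumrN; apply: (@le_trans _ _ (\sum_j M * m j)).
    apply: ler_sum => j _; apply: le_trans (ler_norm _) _.
    by rewrite normrN normrM mulrC (ger0_norm (m_ge0 j)) ler_wpM2r ?S_le.
  by rewrite -mulr_sumr ler_wpM2l.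
have := noise_v; lra.
Qed.

Variable c : R.
Hypothesis c_gt0 : 0 < c.
Hypothesis c_le1 : c <= 1.
Hypothesis card_in : c * (n1%:R * n2%:R) <= \sum_(i : G) (grid_le k1 k2 i)%:R.
Hypothesis card_out : c * (n1%:R * n2%:R) <= \sum_(i : G) (~~ grid_le k1 k2 i)%:R.

Let n1r : 0 < n1%:R :> R. Proof. by rewrite ltr0n. Qed.
Let n2r : 0 < n2%:R :> R. Proof. by rewrite ltr0n. Qed.

Let card_in' : c * (n1%:R * n2%:R) <= (n1 - k1)%:R * (n2 - k2)%:R.
Proof.
apply: le_trans card_in _; rewrite le_eqVlt; apply/orP; left; apply/eqP.
have := @sum_rect R n1 n2 (fun=> 1) (fun=> 1) k1 n1 k2 n2 (leqnn _) (leqnn _).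
rewrite !sumr_const_nat => <-; apply: eq_bigr => i _.
by rewrite !mul1r /in_rect /grid_le !ltn_ord !andbT.
Qed.

Let side1 : c * n1%:R <= (n1 - k1)%:R.
Proof.
have h : (n2 - k2)%:R <= n2%:R :> R by rewrite ler_nat leq_subr.
rewrite -(ler_pM2r n2r) -mulrA; apply: le_trans card_in' _.
by rewrite ler_wpM2l.
Qed.

Let side2 : c * n2%:R <= (n2 - k2)%:R.
Proof.
have h : (n1 - k1)%:R <= n1%:R :> R by rewrite ler_nat leq_subr.
rewrite -(ler_pM2l n1r) mulrCA; apply: le_trans card_in' _.
by rewrite ler_wpM2r.
Qed.

(** The complement of the jump quadrant is the union of the two strips before [k1] and before
    [k2]. *)
Let card_out' : c * (n1%:R * n2%:R) <= k1%:R * n2%:R + n1%:R * k2%:R.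
Proof.
apply: le_trans card_out _.
have := @sum_rect R n1 n2 (fun=> 1) (fun=> 1) 0 k1 0 n2 k1n (leqnn _).
have := @sum_rect R n1 n2 (fun=> 1) (fun=> 1) 0 n1 0 k2 (leqnn _) k2n.
rewrite !sumr_const_nat !subn0 => <- <-; rewrite -big_split/=.
apply: ler_sum => i _; rewrite !mul1r /in_rect /grid_le !ltn_ord !andbT /= !ltnNge.
by case: (k1 <= i.1)%N; case: (k2 <= i.2)%N => /=; rewrite ?addr0 ?add0r// lerDl.
Qed.

(** The constant is halved because only one of the two strips is sure to hold half of the points
    outside the jump. *)
Let half1 : c / 2 * n1%:R <= (n1 - k1)%:R.
Proof. by have := side1; have := mulr_gt0 c_gt0 n1r; lra. Qed.

Let half2 : c / 2 * n2%:R <= (n2 - k2)%:R.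
Proof. by have := side2; have := mulr_gt0 c_gt0 n2r; lra. Qed.

(** Going up from a point off the jump to a point on it, the mixed differences add at most the
    positive mass while the jump removes [g]. So [u] drops by at least [de]. *)
Let jump_gap (i1 i2 p1 p2 : nat) : (i1 <= p1)%N -> (i2 <= p2)%N ->
  (k1 <= p1)%N && (k2 <= p2)%N -> ~~ ((k1 <= i1)%N && (k2 <= i2)%N) ->
  de <= `|cone_fun p1 p2| + `|cone_fun i1 i2|.
Proof.
move=> ip1 ip2 kp ki.
have : cone_fun p1 p2 - cone_fun i1 i2 <= - de.
  rewrite /cone_fun kp (negbTE ki) mulr1 mulr0 /de.
  suff : \sum_j gam j * ((j.1 <= p1)%N && (j.2 <= p2)%N)%:R -
      \sum_j gam j * ((j.1 <= i1)%N && (j.2 <= i2)%N)%:R <= \sum_j p j by lra.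
  rewrite -sumrB; apply: ler_sum => j _; rewrite gamE -mulrBr.
  have := p_ge0 j; have := m_ge0 j.
  have [h1|h1] := boolP ((j.1 <= i1)%N && (j.2 <= i2)%N).
    have -> : (j.1 <= p1)%N && (j.2 <= p2)%N.
      by move: h1 => /andP[h h']; rewrite (leq_trans h)// (leq_trans h').
    by rewrite subrr mulr0; lra.
  by case: (_ && _); rewrite /= ?mulr0n ?mulr1n subr0 ?mulr1 ?mulr0; lra.
have := ler_norm (- cone_fun p1 p2); have := ler_norm (cone_fun i1 i2).
by rewrite normrN; lra.
Qed.

Let r2 := \sum_(i : G) u i ^+ 2.

Let de_sqr : c ^+ 2 * (n1%:R * n2%:R * de ^+ 2) <= 16 * r2.
Proof.
have c2 : 0 <= c / 2 by rewrite divr_ge0 ?ltW.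
suff : c / 2 * n1%:R * (c / 2 * n2%:R) * de ^+ 2 <= 4 * r2 by lra.
(* If the strip before [k1] is wide, rows are used; otherwise [card_out'] makes the strip before
   [k2] wide, and the coordinates are exchanged. *)
have [h|h] := leP (c / 2 * n1%:R) k1%:R.
  apply: (@row_gap _ n1 n2 k1 k2 cone_fun) => // i1 p1 s ik /andP[kp pn] /andP[ks sn].
  apply: jump_gap => //; [exact: leq_trans (ltnW ik) kp|by rewrite kp|].
  by rewrite negb_and -ltnNge ik.
have h' : c / 2 * n2%:R <= k2%:R.
  rewrite -(ler_pM2l n1r); have := card_out'.
  have : k1%:R * n2%:R <= c / 2 * n1%:R * n2%:R by rewrite ler_pM2r// ltW.
  lra.
have -> : r2 = \sum_(i : 'I_n2 * 'I_n1) cone_fun i.2 i.1 ^+ 2.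
  rewrite /r2 -(pair_bigA _ (fun i j => cone_fun (nat_of_ord i) (nat_of_ord j) ^+ 2))/=.
  rewrite exchange_big/=.
  by rewrite (pair_bigA _ (fun i j => cone_fun (nat_of_ord j) (nat_of_ord i) ^+ 2)).
rewrite (mulrC (c / 2 * n1%:R)).
apply: (@row_gap _ n2 n1 k2 k1 (fun i j => cone_fun j i)) => //.
move=> i1 p1 s ik /andP[kp pn] /andP[ks sn].
apply: jump_gap => //; [exact: leq_trans (ltnW ik) kp|by rewrite kp andbT|].
by rewrite negb_and -!ltnNge ik orbT.
Qed.

Let sum_const (e : R) : \sum_(i : G) e = n1%:R * n2%:R * e.
Proof. by rewrite sumr_const card_prod !card_ord -natrM mulr_natl. Qed.

(** Where [v] has the sign of [b], |b| is at most |b + v| <= |u| + 2 de. That holds off the jump if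
    b >= 0 and on it if b < 0, in each case at no less than a fraction [c] of the points. *)
Let b_sqr : c * (n1%:R * n2%:R * b ^+ 2) <= 2 * r2 + 8 * (n1%:R * n2%:R * de ^+ 2).
Proof.
rewrite -!sum_const /r2 !mulr_sumr -big_split/=.
have near_b (P : pred G) : c * (n1%:R * n2%:R) <= \sum_(i : G) (P i)%:R ->
    (forall i, P i -> `|b| <= `|u i| + 2 * de) ->
    \sum_(i : G) c * b ^+ 2 <= \sum_(i : G) (2 * u i ^+ 2 + 8 * de ^+ 2).
  move=> cP bu; rewrite sum_const mulrA (mulrC _ c).
  apply: (@le_trans _ _ (\sum_(i : G) (P i)%:R * b ^+ 2)).
    by rewrite -mulr_suml ler_wpM2r// sqr_ge0.
  apply: ler_sum => i _; case: (boolP (P i)) => [/bu h|_]; last first.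
    by rewrite mul0r addr_ge0// mulr_ge0// sqr_ge0.
  rewrite mul1r -(real_normK (num_real b)) -(real_normK (num_real (u i))).
  have := normr_ge0 b; have := normr_ge0 (u i); have := de_ge0.
  move: `|b| `|u i| de h => x y d h d0 y0 x0.
  have : x ^+ 2 <= (y + 2 * d) ^+ 2 by rewrite lerXn2r ?nnegrE//; lra.
  have := sqr_ge0 (y - 2 * d); lra.
have [b0|b0] := leP 0 b.
  apply: (near_b (fun i => ~~ grid_le k1 k2 i)) => // i kI.
  have : 0 <= v i.
    apply: sumr_ge0 => j _; rewrite mulr_ge0//.
    by rewrite /quadrant_diff (negbTE kI) subr0.
  have := u_approx i; rewrite ler_norml => /andP[h _].
  by have := ler_norm (u i); rewrite (ger0_norm b0); lra.
apply: (near_b (grid_le k1 k2)) => // i kI.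
have : v i <= 0.
  apply: sumr_le0 => j _; rewrite mulr_ge0_le0//.
  by rewrite /quadrant_diff kI subr_le0 lern1 leq_b1.
have := u_approx i; rewrite ler_norml => /andP[_ h].
by have := ler_norm (- u i); rewrite normrN (ltr0_norm b0); lra.
Qed.

Let v_sqr : \sum_i v i ^+ 2 <=
  3 * r2 + 3 * (n1%:R * n2%:R * b ^+ 2) + 12 * (n1%:R * n2%:R * de ^+ 2).
Proof.
rewrite -!sum_const /r2 !mulr_sumr -!big_split/=; apply: ler_sum => i _.
have := u_approx i; move: (u i) (v i) => x y.
set e := x - (b + y) => h.
have -> : y = x - b - e by rewrite /e; ring.
have : e ^+ 2 <= (2 * de) ^+ 2.
  by rewrite -(real_normK (num_real e)) lerXn2r ?nnegrE// mulr_ge0.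
have := sqr_ge0 (x + b); have := sqr_ge0 (x + e); have := sqr_ge0 (b - e).
move: e {h} => e; lra.
Qed.

Lemma noise_tangent_bound :
  2 * \sum_i z i * u i - \sum_(i : G) u i ^+ 2 <= 17000 / c ^+ 3 * (Q * L) ^+ 2.
Proof.
rewrite -/r2; set N := n1%:R * n2%:R : R.
have N0 : 0 < N by rewrite mulr_gt0.
have r20 : 0 <= r2 by apply: sumr_ge0 => i _; exact: sqr_ge0.
set K := c^-1; have K1 : 1 <= K by rewrite invf_ge1.
have cK : c * K = 1 by rewrite mulfV// gt_eqF.
have -> : 17000 / c ^+ 3 = 17000 * K ^+ 3 by rewrite -exprVn.
have K0 : 0 < K by rewrite invr_gt0.
have D : N * de ^+ 2 <= 16 * K ^+ 2 * r2.
  rewrite -(ler_pM2l (exprn_gt0 2 c_gt0)); apply: le_trans de_sqr _.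
  rewrite (_ : c ^+ 2 * _ = 16 * (c * K) ^+ 2 * r2); last by ring.
  by rewrite cK expr1n mulr1.
have K23 : K ^+ 2 <= K ^+ 3 by rewrite ler_weXn2l.
(* 130 = 2 + 8 * 16, from [b_sqr] and [D]. *)
have B : N * b ^+ 2 <= 130 * K ^+ 3 * r2.
  rewrite -(ler_pM2l c_gt0); apply: le_trans b_sqr _.
  rewrite (_ : c * _ = 130 * K ^+ 2 * r2 * (c * K)); last by ring.
  rewrite cK mulr1 -/N.
  have : 1 * r2 <= K ^+ 2 * r2 by rewrite ler_wpM2r// exprn_ege1.
  lra.
(* 585 = 3 + 3 * 130 + 12 * 16, with every power of [K] raised to the third since K >= 1. *)
have W : \sum_i v i ^+ 2 <= 585 * K ^+ 3 * r2.
  apply: le_trans v_sqr _; rewrite -/N.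
  have : K ^+ 2 * r2 <= K ^+ 3 * r2 by rewrite ler_wpM2r.
  have : 1 * r2 <= K ^+ 3 * r2 by rewrite ler_wpM2r// exprn_ege1.
  lra.
set s := rootn R n1 * rootn R n2.
have sN : s ^+ 2 = N by rewrite exprMn !sqr_sqrtr.
(* The remainders in [h1] and [h2] carry 1 / tau, which shrinks them to 388/1000 and 585/1000 of
   [r2]; here 388 = 2 * 130 + 8 * 16. Together they are absorbed by the subtracted [r2]. *)
have [tau tauE] : exists tau, tau = 1000 * K ^+ 3 by eexists.
have tau0 : 0 < tau by have := exprn_gt0 3 K0; rewrite tauE; lra.
have amgm (x y : R) : 2 * (x * y) <= tau * x ^+ 2 + y ^+ 2 / tau.
  have := divr_ge0 (sqr_ge0 (tau * x - y)) (ltW tau0).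
  rewrite (_ : _ / tau = tau * x ^+ 2 + y ^+ 2 / tau - 2 * (x * y)); first by lra.
  by field; rewrite gt_eqF.
have KE (e : R) : e * K ^+ 3 * r2 / tau = e / 1000 * r2.
  by rewrite tauE; field; rewrite gt_eqF.
have h1 : 2 * (Q * s * (`|b| + 2 * de)) <= tau * Q ^+ 2 + 388 / 1000 * r2.
  rewrite -mulrA; apply: le_trans (amgm _ _) _; rewrite lerD2l.
  rewrite -KE ler_pM2r ?invr_gt0// exprMn sN.
  have : N * (`|b| + 2 * de) ^+ 2 <= N * (2 * b ^+ 2 + 8 * de ^+ 2).
    rewrite ler_pM2l// -(real_normK (num_real b)).
    have := sqr_ge0 (`|b| - 2 * de); lra.
  have : N * (8 * de ^+ 2) <= 8 * (16 * K ^+ 3 * r2).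
    rewrite mulrCA ler_pM2l//; apply: le_trans D _.
    by rewrite ler_wpM2r// ler_pM2l.
  lra.
have h2 : 2 * (Q * \sum_i corner_weight i * `|v i|) <=
    tau * Q ^+ 2 * (16 * L ^+ 2) + 585 / 1000 * r2.
  have -> : 2 * (Q * \sum_i corner_weight i * `|v i|) =
      \sum_i 2 * (Q * corner_weight i * `|v i|).
    by rewrite !mulr_sumr; apply: eq_bigr => i _; rewrite -(mulrA Q).
  apply: (@le_trans _ _ (\sum_i (tau * Q ^+ 2 * corner_weight i ^+ 2 + v i ^+ 2 / tau))).
    apply: ler_sum => i _; apply: le_trans (amgm _ _) _.
    by rewrite exprMn mulrA (real_normK (num_real (v i))).
  rewrite big_split/= -mulr_sumr -mulr_suml lerD//.
    by rewrite ler_wpM2l ?sum_corner_weight_sqr// mulr_ge0 ?sqr_ge0// ltW.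
  by rewrite -KE ler_pM2r ?invr_gt0.
have h3 : tau * Q ^+ 2 * 1 <= tau * Q ^+ 2 * L ^+ 2.
  by rewrite ler_wpM2l ?mulr_ge0 ?sqr_ge0 ?(ltW tau0)// exprn_ege1// L_ge1.
(* 17 = 16 + 1, the 1 being the term [tau * Q ^+ 2] of [h1], bounded using L >= 1. *)
rewrite (_ : 17000 * _ * _ = 17 * (tau * Q ^+ 2 * L ^+ 2)); last by rewrite tauE; ring.
have := noise_cone_fun; rewrite -/s; lra.
Qed.

End tangent_noise.

(** * Gaussian maxima *)

Section weighted_transfer.
Local Open Scope ereal_scope.
Context d1 d2 (T : measurableType d1) (Y : measurableType d2) (R : realType).
Variables (mu : {measure set T -> \bar R}) (nu : {measure set Y -> \bar R}).
Variables (X : T -> Y) (W : T -> R).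
Hypothesis mX : measurable_fun setT X.
Hypothesis mW : measurable_fun setT W.
Hypothesis W_ge0 : forall x, (0 <= W x)%R.
Hypothesis muW : forall A, measurable A ->
  \int[mu]_x (W x * \1_A (X x))%:E = nu A.

Import HBNNSimple.

(** The identity on indicators passes to simple functions by linearity and to [f] by monotone
    convergence. It serves for densities (X the identity), for laws (W = 1) and for independence (W
    the product of the other factors). *)
Lemma ge0_integral_weighted_comp (f : Y -> R) : measurable_fun setT f ->
  (forall y, (0 <= f y)%R) ->
  \int[mu]_x (W x * f (X x))%:E = \int[nu]_y (f y)%:E.
Proof.
move=> mf f0.
have mEf := (measurable_EFinP setT f).2 mf.
pose h := nnsfun_approx measurableT mEf.
have hf y : EFin \o h^~ y @ \oo --> (f y)%:E.
  by apply: cvg_nnsfun_approx => // x _; rewrite lee_fin.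
have nd_h y : {homo h^~ y : m n / (m <= n)%N >-> (m <= n)%R}.
  by move=> m n mn; exact/lefP/nd_nnsfun_approx.
have mWX (g : Y -> R) : measurable_fun setT g ->
    measurable_fun setT (fun x => (W x * g (X x))%:E).
  move=> mg; apply/measurable_EFinP; apply: measurable_funM => //.
  exact: measurableT_comp.
have -> : \int[nu]_y (f y)%:E = limn (fun n => \int[nu]_y (h n y)%:E).
  under eq_integral do rewrite -(cvg_lim _ (hf _))//.
  apply: monotone_convergence => //.
  - by move=> n; exact/measurable_EFinP/measurable_funP.
  - by move=> n y _; rewrite lee_fin.
  - by move=> y _ m n mn; rewrite lee_fin nd_h.
have -> : \int[mu]_x (W x * f (X x))%:E =
    limn (fun n => \int[mu]_x (W x * h n (X x))%:E).
  have hfW x : (fun n => (W x * h n (X x))%:E) @ \oo --> (W x * f (X x))%:E.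
    under eq_fun do rewrite EFinM.
    rewrite EFinM; apply: cvgeZl => //; exact: hf.
  under eq_integral do rewrite -(cvg_lim _ (hfW _))//.
  apply: monotone_convergence => //.
  - by move=> n; exact: mWX.
  - by move=> n x _; rewrite lee_fin mulr_ge0.
  - by move=> x _ m n mn; rewrite lee_fin ler_wpM2l// nd_h.
congr (limn _); apply/funext => n.
have mA r : measurable (h n @^-1` [set r]) by [].
rewrite (_ : (fun y => _) = (fun y => \sum_(r \in range (h n))
    (r * \1_(h n @^-1` [set r]) y)%:E)); last first.
  by apply/funext => y; rewrite fsumEFin// -fimfunE.
rewrite (_ : (fun x => (W x * _)%:E) = (fun x => \sum_(r \in range (h n))
    (r%:E * (W x * \1_(h n @^-1` [set r]) (X x))%:E))); last first.
  apply/funext => x; rewrite fimfunE mulr_fsumr -fsumEFin//.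
  by apply: eq_fsbigr => r _; rewrite -EFinM mulrCA.
have mind r : measurable_fun setT (\1_(h n @^-1` [set r]) : Y -> R).
  exact: measurable_indic.
have ind0 r y : 0 <= (r * \1_(h n @^-1` [set r]) y)%:E.
  by rewrite EFinM nnfun_muleindic_ge0.
rewrite !ge0_integral_fsum//; first last.
- by move=> r x _; rewrite -EFinM mulrCA lee_fin mulr_ge0// -lee_fin.
- move=> r; rewrite (_ : (fun x => _) =
    (fun x => (W x * (r * \1_(h n @^-1` [set r]) (X x)))%:E)); last first.
    by apply/funext => x; rewrite -EFinM mulrCA.
  apply: (mWX (fun y => r * \1_(h n @^-1` [set r]) y)%R).
  exact: measurable_funM.
- by move=> r; apply/measurable_EFinP; apply: measurable_funM.
apply: eq_fsbigr => r /[!inE] -[y _ <-].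
rewrite ge0_integralZl ?lee_fin//; first last.
- by move=> x _; rewrite lee_fin mulr_ge0.
- exact: mWX.
rewrite muW//; under [RHS]eq_integral do rewrite EFinM.
rewrite ge0_integralZl ?lee_fin//; first last.
- exact/measurable_EFinP.
- by rewrite integral_indic// setIT.
Qed.

End weighted_transfer.

Section independence.
Local Open Scope ereal_scope.
Context d (T : measurableType d) (R : realType) (P : probability T R).
Variables (I : finType) (X : I -> {RV P >-> R}).
Hypothesis X_indep : mutually_independent X.

(* Indicators are replaced by general functions one coordinate at a time: the
   independence hypothesis determines the measure with density the product of
   the other factors on every measurable set, so no pi-lambda argument is
   needed. *)
Lemma expectation_prod_indep (F : I -> R -> R) (e : I -> R) :
  (forall i, measurable_fun setT (F i)) -> (forall i x, (0 <= F i x)%R) ->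
  (forall i, \int[P]_w (F i (X i w))%:E = (e i)%:E) ->
  \int[P]_w (\prod_i F i (X i w))%:E = (\prod_i e i)%:E.
Proof.
(* Coordinates outside [s] carry indicators; each induction step frees the factor at the head of
   [s]. *)
suff main (s : seq I) : forall (F : I -> R -> R) (e : I -> R),
    (forall i, measurable_fun setT (F i)) -> (forall i x, (0 <= F i x)%R) ->
    (forall i, \int[P]_w (F i (X i w))%:E = (e i)%:E) ->
    (forall i, i \notin s -> exists2 A, measurable A & F i = \1_A) ->
    \int[P]_w (\prod_i F i (X i w))%:E = (\prod_i e i)%:E.
  by move=> mF F0 Fe; apply: (main (enum I)) => // i; rewrite mem_enum.
elim: s => [|i0 s ih] {}F {}e mF F0 Fe Find.
  have [A AP] := choice (fun i => (exists2P _ _).1 (Find i isT)).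
  have FX i w : F i (X i w) = \1_(X i @^-1` A i) w by rewrite (AP i).2.
  have PA i : P (X i @^-1` A i) = (e i)%:E.
    rewrite -Fe; under eq_integral do rewrite FX.
    rewrite integral_indic ?setIT// -[X in measurable X]setTI.
    by apply: measurable_funP => //; exact: (AP i).1.
  (* A product of indicators is the indicator of an intersection, so independence applies with the
     full index set. *)
  transitivity (P (\bigcap_(i in [set j | j \in [set: I]%SET]) X i @^-1` A i)).
    rewrite -[in RHS](setIT (\bigcap_(i in _) _)) -integral_indic//.
      apply: eq_integral => w _; congr EFin.
      under eq_bigr do rewrite FX.
      rewrite indicE; case: (boolP (w \in _)) => [/[!inE] wA|wA].
        rewrite big1// => i _; rewrite indicE mem_set//.
        by apply: wA => /=; rewrite inE.
      have [i] : exists i, ~ A i (X i w).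
        apply/existsNP => allA; move/negP: wA; apply; rewrite inE => i _.
        exact: allA.
      by move=> Ai; rewrite (bigD1 i)//= indicE memNset ?mul0r.
    apply: fin_bigcap_measurable => // i _.
    rewrite -[X in measurable X]setTI.
    by apply: measurable_funP => //; exact: (AP i).1.
  rewrite X_indep; last by move=> i; exact: (AP i).1.
  rewrite -prodEFin; apply: eq_big => [i|i _]; first by rewrite inE.
  exact: PA.
have e0 i : (0 <= e i)%R.
  by rewrite -lee_fin -Fe integral_ge0// => w _; rewrite lee_fin.
have c0 : (0 <= \prod_(i | i != i0) e i)%R by exact: prodr_ge0.
pose W w := (\prod_(i | i != i0) F i (X i w))%R.
(* The measure of density [W], pushed forward by [X i0], must be this multiple of the law of [X i0];
   the induction hypothesis with an indicator at [i0] shows it. *)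
pose nu := mscale (NngNum c0) (distribution P (X i0)).
transitivity (\int[P]_w (W w * F i0 (X i0 w))%:E).
  by apply: eq_integral => w _; rewrite (bigD1 i0)//= mulrC.
rewrite (@ge0_integral_weighted_comp _ _ _ _ _ P nu) => //.
- rewrite ge0_integral_mscale//=; last 2 first.
    exact/measurable_EFinP.
    by move=> x _; rewrite lee_fin.
  rewrite ge0_integral_distribution//; last 2 first.
    exact/measurable_EFinP.
    by move=> x; rewrite lee_fin.
  by rewrite /= Fe -EFinM [in RHS](bigD1 i0)//= mulrC.
- rewrite /W (_ : (fun w => _) = (fun w =>
    \prod_(i <- [seq i <- index_enum I | i != i0]) F i (X i w))%R).
    apply: measurable_prod => i _; apply: measurableT_comp => //.
  by apply/funext => w; rewrite big_filter.
- by move=> w; apply: prodr_ge0.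
- move=> A mA.
  have mXA : measurable (X i0 @^-1` A).
    rewrite -[X in measurable X]setTI.
    exact: measurable_funP.
  pose F' i := if i == i0 then \1_A else F i.
  pose e' i := if i == i0 then fine (P (X i0 @^-1` A)) else e i.
  have := ih F' e'; rewrite /F' /e' (bigD1 i0)//= eqxx => ih'.
  transitivity ((fine (P (X i0 @^-1` A)) * \prod_(i | i != i0) e i)%:E).
    rewrite -[in RHS](_ : (\prod_(i | i != i0)
        (if i == i0 then fine (P (X i0 @^-1` A)) else e i))%R =
      (\prod_(i | i != i0) e i)%R); last first.
      by apply: eq_bigr => i /negbTE ->.
    rewrite -ih'; first last.
    - move=> i si; have [_|ii0] := eqVneq i i0; first by exists A.
      by apply: Find; rewrite inE negb_or ii0.
    - move=> i; have [->|ii0] := eqVneq i i0; last exact: Fe.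
      rewrite fineK ?fin_num_measure//.
      rewrite (_ : (fun w => _) = (fun w => (\1_(X i0 @^-1` A) w)%:E))//.
      by rewrite integral_indic// setIT.
    - by move=> i x; case: ifP.
    - by move=> i; case: ifP => // _; exact: measurable_indic.
    apply: eq_integral => w _; congr EFin; rewrite (bigD1 i0)//= eqxx mulrC.
    by congr (_ * _)%R; apply: eq_bigr => i /negbTE ->.
  by rewrite /nu /mscale/= EFinM fineK ?fin_num_measure// muleC.
Qed.

End independence.

Section gaussian_mgf.
Context (R : realType).
Local Open Scope ereal_scope.

(** Completing the square: the tilted density is a constant times the normal density of mean l
    sigma^2. *)
Lemma normal_mgf (sigma l : R) : (0 < sigma)%R ->
  \int[normal_prob 0 sigma]_x (expR (l * x))%:E =
  (expR (l ^+ 2 * sigma ^+ 2 / 2))%:E.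
Proof.
move=> s0; have s0' : sigma != 0%R by rewrite gt_eqF.
have mexp : measurable_fun setT (fun x : R => expR (l * x)).
  by apply: measurableT_comp => //; exact: measurable_funM.
have mpdf := measurable_normal_pdf (0 : R) sigma.
rewrite -(@ge0_integral_weighted_comp _ _ _ _ R (@lebesgue_measure R)
  (normal_prob 0 sigma) id (normal_pdf 0 sigma))//; last 2 first.
- exact: normal_pdf_ge0.
- move=> A mA; rewrite [RHS]integral_mkcond; apply: eq_integral => x _.
  by rewrite patchE indicE; case: ifP; rewrite ?mulr1 ?mulr0.
transitivity (\int[lebesgue_measure]_x ((expR (l ^+ 2 * sigma ^+ 2 / 2))%:E *
    (normal_pdf (l * sigma ^+ 2) sigma x)%:E)); last first.
  rewrite ge0_integralZl_EFin ?expR_ge0//.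
  - by rewrite integral_normal_pdf mule1.
  - by move=> x _; rewrite lee_fin normal_pdf_ge0.
  - by apply/measurable_EFinP; exact: measurable_normal_pdf.
have square (x : R) : (- (x - 0) ^+ 2 / (sigma ^+ 2 *+ 2) + l * x =
    l ^+ 2 * sigma ^+ 2 / 2 + - (x - l * sigma ^+ 2) ^+ 2 / (sigma ^+ 2 *+ 2))%R.
  by rewrite -mulr_natr; field.
apply: eq_integral => x _; rewrite -EFinM; congr EFin.
rewrite !normal_pdfE// /normal_fun -[LHS]mulrA (mulrCA (expR _)); congr (_ * _)%R.
by rewrite -!expRD square.
Qed.

End gaussian_mgf.

Section gaussian_maximum.
Context d (T : measurableType d) (R : realType) (P : probability T R).
Variables (I : finType) (sigma : R) (X : I -> {RV P >-> R}).
Hypothesis sigma_gt0 : 0 < sigma.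
Hypothesis X_iid : iid_normal sigma X.

Lemma gaussian_linear_mgf (l : I -> R) :
  (\int[P]_w (expR (\sum_i l i * X i w))%:E =
   (expR (sigma ^+ 2 * (\sum_i l i ^+ 2) / 2))%:E)%E.
Proof.
have mexp i : measurable_fun setT (fun x : R => expR (l i * x)).
  by apply: measurableT_comp => //; exact: measurable_funM.
rewrite (_ : sigma ^+ 2 * _ / 2 = \sum_i l i ^+ 2 * sigma ^+ 2 / 2); last first.
  by rewrite mulr_sumr mulr_suml; apply: eq_bigr => i _; rewrite (mulrC (_ ^+ 2)).
rewrite expR_sum; under eq_integral do rewrite expR_sum.
apply: (expectation_prod_indep X_iid.1 (F := fun i x => expR (l i * x))) => //.
move=> i; rewrite -normal_mgf//.
have mX : measurable_fun setT (X i : T -> measurableTypeR R).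
  exact: (measurable_funPT (X i)).
rewrite -(@ge0_integral_weighted_comp _ _ _ _ _ P (normal_prob 0 sigma) _ (cst 1) mX)//.
- by apply: eq_integral => w _; rewrite mul1r.
- move=> A mA; transitivity (distribution P (X i) A); last exact: X_iid.2.
  under eq_integral do rewrite mul1r.
  rewrite (_ : (fun w => _) = (fun w => (\1_(X i @^-1` A) w)%:E))//.
  rewrite integral_indic// ?setIT// -[X in measurable X]setTI.
  exact: measurable_funP.
- exact: mexp.
Qed.

(** Take t >= 0. If t <= a, the first term suffices. Otherwise exp (a (t - a)) >= (t - a)^2 / 2
    because a >= 1, and t^2 <= 2 a^2 + 2 (t - a)^2. *)
Lemma sqr_le_cosh (a t : R) : 1 <= a ->
  t ^+ 2 <= 2 * a ^+ 2 +
    4 * (expR (- a ^+ 2) * (expR (a * t) + expR (- (a * t)))).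
Proof.
move=> a1; wlog t0 : t / 0 <= t => [th|].
  have [|t0] := leP 0 t; first exact: th.
  have := th (- t); rewrite sqrrN mulrN opprK (addrC (expR (- (a * t)))).
  by apply; rewrite oppr_ge0 ltW.
have e0 := expR_ge0 (- a ^+ 2); have e1 := expR_ge0 (- (a * t)).
rewrite mulrDr -expRD.
have p0 := mulr_ge0 e0 e1.
have [ta|ta] := leP t a.
  have := expR_ge0 (- a ^+ 2 + a * t).
  have : t ^+ 2 <= a ^+ 2 by rewrite lerXn2r ?nnegrE//; lra.
  by have := sqr_ge0 a; lra.
rewrite (_ : - a ^+ 2 + a * t = a * (t - a)); last by ring.
have s0 : 0 <= a * (t - a) by rewrite mulr_ge0 ?subr_ge0 ?(ltW ta)//; lra.
have := expR_ge1Dxn 1 s0; rewrite !factS fact0.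
have : (t - a) ^+ 2 <= (a * (t - a)) ^+ 2.
  rewrite lerXn2r ?nnegrE ?subr_ge0 ?(ltW ta)//.
  by rewrite ler_peMl// subr_ge0 ltW.
have := sqr_ge0 (t - 2 * a).
rewrite !muln1; lra.
Qed.

(** A sum of exponentials stands in for the maximum: by [sqr_le_cosh] it dominates every square
    pointwise, and each exponential has mean at most exp (a^2 / 2) since the variances are at most
    1. Multiplied by 4 exp (- a^2), the 2 #|K| means give the last term. *)
Lemma gaussian_max (K : finType) (l : K -> I -> R) (a : R) : 1 <= a ->
  (forall k, sigma ^+ 2 * \sum_i l k i ^+ 2 <= 1) ->
  exists G : T -> R, [/\ measurable_fun setT G, forall w, 0 <= G w,
    forall k w, (\sum_i l k i * X i w) ^+ 2 <= G w &
    (\int[P]_w (G w)%:E <= (2 * a ^+ 2 + 8 * (#|K|%:R * expR (- (a ^+ 2 / 2))))%:E)%E].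
Proof.
move=> a1 lk.
pose Z k w := \sum_i l k i * X i w.
pose H k w := expR (a * Z k w) + expR (- (a * Z k w)).
pose b := 4 * expR (- a ^+ 2).
have b0 : 0 <= b by rewrite mulr_ge0 ?expR_ge0.
have H0 k w : 0 <= H k w by rewrite addr_ge0 ?expR_ge0.
have mZ k : measurable_fun setT (Z k).
  by apply: measurable_sum => i; exact: measurable_funM.
have mexp k (e : R) : measurable_fun setT (fun w => expR (e * Z k w)).
  by apply: measurableT_comp => //; exact: measurable_funM.
have HE k : H k = (fun w => expR (a * Z k w) + expR (- a * Z k w)).
  by apply/funext => w; rewrite /H mulNr.
have mH k : measurable_fun setT (H k) by rewrite HE; exact: measurable_funD.
have intexp k (e : R) : e ^+ 2 = a ^+ 2 ->
    (\int[P]_w (expR (e * Z k w))%:E <= (expR (a ^+ 2 / 2))%:E)%E.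
  move=> ea; under eq_integral do rewrite mulr_sumr.
  under eq_integral do under eq_bigr do rewrite mulrA.
  rewrite gaussian_linear_mgf lee_fin ler_expR ler_pM2r//.
  under eq_bigr do rewrite exprMn ea.
  by rewrite -mulr_sumr mulrCA ler_piMr ?sqr_ge0.
exists (fun w => 2 * a ^+ 2 + b * \sum_k H k w); split.
- apply: measurable_funD => //; apply: measurable_funM => //.
  exact: measurable_sum.
- move=> w; rewrite addr_ge0//; first by rewrite mulr_ge0 ?sqr_ge0.
  by rewrite mulr_ge0// sumr_ge0.
- move=> k w; apply: le_trans (sqr_le_cosh (Z k w) a1) _.
  rewrite lerD2l mulrA ler_wpM2l// (bigD1 k)//= lerDl sumr_ge0//.
under eq_integral do rewrite EFinD.
rewrite ge0_integralD//; first last.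
- apply/measurable_EFinP; apply: measurable_funM => //; exact: measurable_sum.
- by move=> w _; rewrite lee_fin mulr_ge0// sumr_ge0.
- by move=> w _; rewrite lee_fin mulr_ge0 ?sqr_ge0.
rewrite integral_cst//= probability_setT mule1 EFinD leeD//.
under eq_integral do rewrite EFinM -sumEFin.
rewrite ge0_integralZl//; first last.
- by move=> w _; rewrite sume_ge0// => k _; rewrite lee_fin.
- by apply: emeasurable_sum => k; exact/measurable_EFinP.
rewrite ge0_integral_sum//; first last.
- by move=> k w _; rewrite lee_fin.
- by move=> k; exact/measurable_EFinP.
apply: (@le_trans _ _ (b%:E * \sum_(k : K) (2 * expR (a ^+ 2 / 2))%:E)%E).
  rewrite lee_wpmul2l ?lee_fin//; apply: lee_sum => k _.
  rewrite HE; under eq_integral do rewrite EFinD.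
  rewrite ge0_integralD//; first last.
  - exact/measurable_EFinP.
  - exact/measurable_EFinP.
  by rewrite mulr2n mulrDl mul1r EFinD leeD ?intexp ?sqrrN.
rewrite sumEFin -EFinM lee_fin sumr_const -(mulr_natl (2 * _)) /b.
rewrite (_ : 4 * _ * _ =
  8 * (#|K|%:R * (expR (- a ^+ 2) * expR (a ^+ 2 / 2)))); last by ring.
by rewrite -expRD (_ : - a ^+ 2 + a ^+ 2 / 2 = - (a ^+ 2 / 2)); last by field.
Qed.

End gaussian_maximum.

(** * Hardy-Krause variation on the grid *)

Section hk0_on_grid.
Variable R : realType.

Definition grid_point (n i : nat) : R := i%:R / n%:R.

(** The initial 0 is omitted, as in [itv_partition]; the final point 1 lies outside the design. *)
Definition uniform_partition n : seq R := [seq grid_point n i | i <- iota 1 n].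

Lemma uniform_partition_cons n :
  0 :: uniform_partition n = [seq grid_point n i | i <- iota 0 n.+1].
Proof. by rewrite /= /grid_point mul0r. Qed.

Lemma nth_uniform_partition n l : (l <= n)%N ->
  nth 1 (0 :: uniform_partition n) l = grid_point n l.
Proof.
move=> ln; rewrite uniform_partition_cons (nth_map 0%N) ?size_iota ?ltnS//.
by rewrite nth_iota ?ltnS.
Qed.

Lemma size_uniform_partition n : size (uniform_partition n) = n.
Proof. by rewrite size_map size_iota. Qed.

Lemma itv_uniform_partition n : (0 < n)%N ->
  itv_partition 0 1 (uniform_partition n).
Proof.
move=> n0; split.
  suff : sorted <%R (0 :: uniform_partition n) by [].
  rewrite uniform_partition_cons.
  apply: (homo_sorted (e := ltn)) (iota_ltn_sorted _ _) => i j ij.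
  by rewrite /grid_point ltr_pM2r ?invr_gt0 ?ltr0n// ltr_nat.
rewrite -[last _ _]/(last 0 (0 :: uniform_partition n)) -nth_last.
rewrite -[(size _).-1]/(size (uniform_partition n)) size_uniform_partition.
rewrite (set_nth_default 1) /= ?size_uniform_partition ?ltnS//.
by rewrite nth_uniform_partition// /grid_point divff// pnatr_eq0 -lt0n.
Qed.

(** [F] is continued by 0 before index 0, so that summation inverts the difference. *)
Definition backward_diff (F : nat -> R) (i : nat) : R :=
  if i is i'.+1 then F i'.+1 - F i' else F 0%N.

Lemma sum_backward_diff F n i : (i < n)%N ->
  \sum_(j < n) backward_diff F j * (j <= i)%N%:R = F i.
Proof.
move=> ni; rewrite (eq_bigr (fun j : 'I_n => backward_diff F j * (0 <= j < i.+1)%N%:R)).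
  rewrite sum_ord_between// big_nat_recl//= telescope_sumr//.
  by rewrite addrC subrK.
by move=> j _; rewrite /= ltnS.
Qed.

Variables n1 n2 : nat.
Local Notation G := ('I_n1 * 'I_n2)%type.
Variable f : R * R -> R.

(** At the origin this is the value of [f], on the axes a one-dimensional increment, elsewhere the
    increment over a cell: the three kinds of terms of the variation, and the value it ignores. *)
Definition mixed_diff (j1 j2 : nat) : R :=
  backward_diff (fun i1 => backward_diff (fun i2 =>
    f (grid_point n1 i1, grid_point n2 i2)) j2) j1.

Lemma sum_mixed_diff (i : G) :
  \sum_(j : G) mixed_diff j.1 j.2 * ((j.1 <= i.1)%N && (j.2 <= i.2)%N)%:R =
  f (grid_point n1 i.1, grid_point n2 i.2).
Proof.
rewrite -(pair_bigA _ (fun j1 j2 => mixed_diff (nat_of_ord j1) (nat_of_ord j2) *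
  ((j1 <= i.1)%N && (j2 <= i.2)%N)%:R))/= exchange_big/=.
rewrite -(sum_backward_diff
  (fun i2 => f (grid_point n1 i.1, grid_point n2 i2)) (ltn_ord i.2)).
apply: eq_bigr => j2 _.
rewrite -(sum_backward_diff (fun i1 => backward_diff (fun i2 =>
  f (grid_point n1 i1, grid_point n2 i2)) j2) (ltn_ord i.1)).
by rewrite mulr_suml; apply: eq_bigr => j1 _; rewrite -mulnb natrM mulrA.
Qed.

Hypothesis n1_gt0 : (0 < n1)%N.
Hypothesis n2_gt0 : (0 < n2)%N.

Lemma mixed_diff_le_hk0 (V : R) : (hk0_variation f <= V%:E)%E ->
  \sum_(j : G | (0 < j.1 + j.2)%N) `|mixed_diff j.1 j.2| <= V.
Proof.
move=> fV.
have p1 := itv_uniform_partition n1_gt0.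
have p2 := itv_uniform_partition n2_gt0.
have z1 : grid_point n1 0 = 0 by rewrite /grid_point mul0r.
have z2 : grid_point n2 0 = 0 by rewrite /grid_point mul0r.
pose x := \sum_(l < n1) `|mixed_diff l.+1 0|.
pose y := \sum_(l < n2) `|mixed_diff 0 l.+1|.
pose z := \sum_(l1 < n1) \sum_(l2 < n2) `|mixed_diff l1.+1 l2.+1|.
have hx : (x%:E <= total_variation 0%R 1%R (fun t : R => f (t, 0%R)))%E.
  apply: ereal_sup_ubound; exists x => //; exists (uniform_partition n1) => //.
  rewrite /variation size_uniform_partition big_mkord; apply: eq_bigr => l _.
  by rewrite /= -[nth 1 (uniform_partition _) _]/(nth 1 (0 :: uniform_partition n1) l.+1)
    !nth_uniform_partition ?(ltnW (ltn_ord l))// /mixed_diff /= z2.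
have hy : (y%:E <= total_variation 0%R 1%R (fun t : R => f (0%R, t)))%E.
  apply: ereal_sup_ubound; exists y => //; exists (uniform_partition n2) => //.
  rewrite /variation size_uniform_partition big_mkord; apply: eq_bigr => l _.
  by rewrite /= -[nth 1 (uniform_partition _) _]/(nth 1 (0 :: uniform_partition n2) l.+1)
    !nth_uniform_partition ?(ltnW (ltn_ord l))// /mixed_diff /= z1.
have hz : (z%:E <= vitali_variation f)%E.
  apply: ereal_sup_ubound; exists (uniform_partition n1, uniform_partition n2) => //.
  congr EFin; rewrite /vitali_sum/= !size_uniform_partition.
  apply: eq_bigr => l1 _; apply: eq_bigr => l2 _.
  rewrite -[nth 1 (uniform_partition n1) _]/(nth 1 (0 :: uniform_partition n1) l1.+1).
  rewrite -[nth 1 (uniform_partition n2) _]/(nth 1 (0 :: uniform_partition n2) l2.+1).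
  rewrite !nth_uniform_partition ?(ltnW (ltn_ord l1)) ?(ltnW (ltn_ord l2))//.
  by rewrite /mixed_diff /=; congr `|_|; ring.
have xyz : x + y + z <= V.
  by rewrite -lee_fin; apply: le_trans fV; rewrite !EFinD !leeD.
apply: le_trans xyz.
(* The uniform partition has one more increment per axis than the design, the one ending at 1; it is
   nonnegative and only enlarges the bound. *)
have cut n (F : nat -> R) : (forall i, 0 <= F i) -> (0 < n)%N ->
    \sum_(i < n) F i <= F 0%N + \sum_(i < n) F i.+1.
  case: n => // n F0 _; rewrite big_ord_recl lerD2l big_ord_recr/=.
  by rewrite lerDl.
rewrite big_mkcond/=.
rewrite -(pair_bigA _ (fun j1 j2 => if (0 < nat_of_ord j1 + nat_of_ord j2)%N
  then `|mixed_diff j1 j2| else 0))/=.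
apply: (@le_trans _ _ (y + (x + z))); last by rewrite addrA (addrC y).
pose H j1 j2 := if (0 < j1 + j2)%N then `|mixed_diff j1 j2| else 0.
have H0 j1 j2 : 0 <= H j1 j2 by rewrite /H; case: ifP.
apply: le_trans (cut n1 (fun j1 => \sum_(j2 < n2) H j1 j2) _ n1_gt0) _.
  by move=> j1; exact: sumr_ge0.
apply: lerD.
  apply: le_trans (cut n2 (H 0%N) (H0 0%N) n2_gt0) _.
  by rewrite /H/= add0r.
rewrite /x /z -big_split/=; apply: ler_sum => j1 _.
exact: le_trans (cut n2 (H j1.+1) (H0 _) n2_gt0) _.
Qed.

End hk0_on_grid.

Section hk0_one_jump.
Variable R : realType.
Variables (f : R * R -> R) (a1 a0 : R) (xs : R * R).
Hypothesis xs_box : box (0, 0) (1, 1) xs.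
Hypothesis fE : forall p, box (0, 0) (1, 1) p -> f p = a1 * \1_(box xs (1, 1)) p + a0.

Definition step (t x : R) : R := (t <= x)%R%:R.

Lemma one_jumpE p : box (0, 0) (1, 1) p ->
  f p = a1 * (step xs.1 p.1 * step xs.2 p.2) + a0.
Proof.
move=> pb; rewrite fE//; congr (_ * _ + _).
move: pb; rewrite /box /step indicE => -[/=].
rewrite !in_itv/= => /andP[_ p1] /andP[_ p2].
rewrite -natrM mulnb; congr (nat_of_bool _)%:R; apply/idP/idP.
  by rewrite inE /= !in_itv/= p1 p2 !andbT => -[-> ->].
by move=> /andP[h1 h2]; rewrite inE /= !in_itv/= p1 p2 h1 h2.
Qed.

(** A monotone function varies by its total increase; a step located at 0 does not vary at all. *)
Lemma step_variation (t : R) (s : seq R) : t <= 1 -> itv_partition 0 1 s ->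
  \sum_(l < size s) `|step t (nth 1 (0 :: s) l.+1) - step t (nth 1 (0 :: s) l)| =
  1 - step t 0.
Proof.
move=> t1 s01; have nd : {in `[0, 1] &, nondecreasing_fun (step t)}.
  move=> x y _ _ xy; rewrite /step ler_nat.
  by case: (leP t x) => // tx; rewrite (le_trans tx xy).
have := nondecreasing_variation nd s01; rewrite /variation big_mkord => ->.
by rewrite {1}/step t1.
Qed.

Lemma nth_partition_box (s1 s2 : seq R) l1 l2 :
  itv_partition 0 1 s1 -> itv_partition 0 1 s2 ->
  (l1 <= size s1)%N -> (l2 <= size s2)%N ->
  box (0, 0) (1, 1) (nth 1 (0 :: s1) l1, nth 1 (0 :: s2) l2).
Proof.
move=> p1 p2 h1 h2; split; rewrite /= in_itv/=; apply/andP; split.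
- exact: (itv_partition_nth_ge _ p1).
- exact: (itv_partition_nth_le _ p1).
- exact: (itv_partition_nth_ge _ p2).
- exact: (itv_partition_nth_le _ p2).
Qed.

(** Let p and q be 1 or 0 according to whether the first and the second coordinate of the corner
    vanish. The three terms are at most |a1| times q (1 - p), p (1 - q) and (1 - p) (1 - q), with
    sum |a1| (1 - p q). *)
Lemma one_jump_hk0 : (hk0_variation f <= `|a1|%:E)%E.
Proof.
have [/=] := xs_box; rewrite !in_itv/= => /andP[_ t1] /andP[_ t2].
pose p := step xs.1 0; pose q := step xs.2 0.
have box0 (s : seq R) l : itv_partition 0 1 s -> (l <= size s)%N ->
    0 <= nth 1 (0 :: s) l <= 1.
  move=> h hl; apply/andP; split.
    exact: (itv_partition_nth_ge _ h).
  exact: (itv_partition_nth_le _ h).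
have h1 : (total_variation 0%R 1%R (fun t : R => f (t, 0%R)) <=
    (`|a1| * q * (1 - p))%:E)%E.
  apply: ge_ereal_sup => _ [_ [s s01 <-] <-]; rewrite lee_fin.
  rewrite /variation big_mkord -(step_variation t1 s01) mulr_sumr.
  apply: ler_sum => l _; rewrite [(_ \o _) _]/= [X in _ - X]/=.
  rewrite -[nth 1 s l]/(nth 1 (0 :: s) l.+1) !one_jumpE; last 2 first.
    by split; rewrite /= in_itv/= ?lexx ?ler01//; apply: (box0 s l s01); exact: ltnW.
    by split; rewrite /= in_itv/= ?lexx ?ler01//; exact: (box0 s l.+1 s01).
  rewrite /= -/q; set x := step _ _; set y := step _ _.
  have -> : a1 * (x * q) + a0 - (a1 * (y * q) + a0) = a1 * q * (x - y) by ring.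
  by rewrite !normrM (ger0_norm (_ : 0 <= q))// /q /step ler0n.
have h2 : (total_variation 0%R 1%R (fun t : R => f (0%R, t)) <=
    (`|a1| * p * (1 - q))%:E)%E.
  apply: ge_ereal_sup => _ [_ [s s01 <-] <-]; rewrite lee_fin.
  rewrite /variation big_mkord -(step_variation t2 s01) mulr_sumr.
  apply: ler_sum => l _; rewrite [(_ \o _) _]/= [X in _ - X]/=.
  rewrite -[nth 1 s l]/(nth 1 (0 :: s) l.+1) !one_jumpE; last 2 first.
    by split; rewrite /= in_itv/= ?lexx ?ler01//; apply: (box0 s l s01); exact: ltnW.
    by split; rewrite /= in_itv/= ?lexx ?ler01//; exact: (box0 s l.+1 s01).
  rewrite /= -/p; set x := step _ _; set y := step _ _.
  have -> : a1 * (p * x) + a0 - (a1 * (p * y) + a0) = a1 * p * (x - y) by ring.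
  by rewrite !normrM (ger0_norm (_ : 0 <= p))// /p /step ler0n.
have h3 : (vitali_variation f <= (`|a1| * ((1 - p) * (1 - q)))%:E)%E.
  apply: ge_ereal_sup => _ [[s s'] [/= s01 s01'] <-]; rewrite lee_fin /vitali_sum.
  rewrite -(step_variation t1 s01) -(step_variation t2 s01') big_distrlr/= mulr_sumr.
  apply: ler_sum => l1 _; rewrite mulr_sumr; apply: ler_sum => l2 _.
  rewrite -[nth 1 s l1]/(nth 1 (0 :: s) l1.+1) -[nth 1 s' l2]/(nth 1 (0 :: s') l2.+1).
  rewrite !one_jumpE; try by apply: nth_partition_box => //; rewrite ltnW.
  rewrite -!normrM /=; set x := step xs.1 _; set y := step xs.2 _.
  set x' := step xs.1 _; set y' := step xs.2 _.
  rewrite le_eqVlt; apply/orP; left; apply/eqP; congr `|_|; ring.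
apply: le_trans (leeD (leeD h1 h2) h3) _; rewrite -!EFinD lee_fin.
have : `|a1| * (p * q) >= 0 by rewrite mulr_ge0// /p /q /step mulr_ge0 ?ler0n.
by have := normr_ge0 a1; lra.
Qed.

End hk0_one_jump.

(** * The basic inequality *)

Section hk0_convexity.
Variable R : realType.
Implicit Types (f g : R * R -> R) (t : R).

Definition convex_comb t f g : R * R -> R := fun p => (1 - t) * f p + t * g p.

Lemma norm_convex (t a b : R) : 0 <= t <= 1 ->
  `|(1 - t) * a + t * b| <= (1 - t) * `|a| + t * `|b|.
Proof.
move=> /andP[t0 t1]; apply: le_trans (ler_normD _ _) _.
by rewrite !normrM (ger0_norm t0) ger0_norm// subr_ge0.
Qed.

Lemma total_variation_convex (f g : R -> R) t : 0 <= t <= 1 ->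
  (total_variation 0%R 1%R (fun x => (1 - t) * f x + t * g x)%R <=
   (1 - t)%:E * total_variation 0%R 1%R f + t%:E * total_variation 0%R 1%R g)%E.
Proof.
move=> t01; have /andP[t0 t1] := t01; have t1' : 0 <= 1 - t by rewrite subr_ge0.
apply: ge_ereal_sup => _ [_ [s s01 <-] <-].
apply: (@le_trans _ _ 
  ((1 - t)%:E * (variation 0 1 f s)%:E + t%:E * (variation 0 1 g s)%:E)%E).
  rewrite -!EFinM -EFinD lee_fin /variation !mulr_sumr -big_split/=.
  apply: ler_sum => l _.
  apply: le_trans (norm_convex _ _ t01); rewrite le_eqVlt; apply/orP; left.
  by apply/eqP; congr `|_|; rewrite /=; ring.
by apply: leeD; rewrite lee_wpmul2l ?lee_fin//; apply: ereal_sup_ubound;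
  apply: imageP; exact: variations_variation.
Qed.

Lemma vitali_variation_convex f g t : 0 <= t <= 1 ->
  (vitali_variation (convex_comb t f g) <=
   (1 - t)%:E * vitali_variation f + t%:E * vitali_variation g)%E.
Proof.
move=> t01; have /andP[t0 t1] := t01; have t1' : 0 <= 1 - t by rewrite subr_ge0.
apply: ge_ereal_sup => _ [[s1 s2] [/= s01 s02] <-].
apply: (@le_trans _ _ 
  ((1 - t)%:E * (vitali_sum f s1 s2)%:E + t%:E * (vitali_sum g s1 s2)%:E)%E).
  rewrite -!EFinM -EFinD lee_fin /vitali_sum !mulr_sumr -big_split/=.
  apply: ler_sum => l1 _; rewrite !mulr_sumr -big_split/=; apply: ler_sum => l2 _.
  apply: le_trans (norm_convex _ _ t01); rewrite le_eqVlt; apply/orP; left.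
  by apply/eqP; congr `|_|; rewrite /convex_comb; ring.
by apply: leeD; rewrite lee_wpmul2l ?lee_fin//; apply: ereal_sup_ubound; exists (s1, s2).
Qed.

(** Nonnegativity lets multiplication distribute over the three terms in [hk0_convex], where they
    may be infinite. *)
Lemma vitali_variation_ge0 f : (0 <= vitali_variation f)%E.
Proof.
apply: (@le_trans _ _ (vitali_sum f [:: 1] [:: 1])%:E).
  by rewrite lee_fin; apply: sumr_ge0 => l1 _; exact: sumr_ge0.
apply: ereal_sup_ubound; exists ([:: 1], [:: 1]) => //.
by split; exact: itv_partition1.
Qed.

Lemma hk0_convex f g t (V : R) : 0 <= t <= 1 ->
  (hk0_variation f <= V%:E)%E -> (hk0_variation g <= V%:E)%E ->
  (hk0_variation (convex_comb t f g) <= V%:E)%E.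
Proof.
move=> t01 fV gV; have /andP[t0 t1] := t01.
have t1' : 0 <= 1 - t by rewrite subr_ge0.
have h1 := @total_variation_convex (fun x => f (x, 0)) (fun x => g (x, 0)) t t01.
have h2 := @total_variation_convex (fun x => f (0, x)) (fun x => g (0, x)) t t01.
have h3 := @vitali_variation_convex f g t t01.
apply: (@le_trans _ _ ((1 - t)%:E * hk0_variation f + t%:E * hk0_variation g)%E).
  apply: (le_trans (leeD (leeD h1 h2) h3)); rewrite /hk0_variation.
  rewrite !ge0_muleDr ?total_variation_ge0 ?adde_ge0 ?total_variation_ge0
    ?vitali_variation_ge0//.
  by rewrite [leRHS]addeACA [X in (_ <= X + _)%E]addeACA.
apply: (@le_trans _ _ ((1 - t)%:E * V%:E + t%:E * V%:E)%E).
  by apply: leeD; rewrite lee_wpmul2l ?lee_fin.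
by rewrite -!EFinM -EFinD lee_fin -mulrDl subrK mul1r.
Qed.

(** [fhat] projects the data onto a convex set in the empirical norm; comparing it with the segment
    from [fhat] to [f] gives <y - fhat, f - fhat> <= 0. *)
Lemma hk0_lse_loss n (x : 'I_n -> R * R) (xi : 'I_n -> R) (V : R) fstar fhat f :
  (0 < n)%N -> hk0_lse x (fun i => fstar (x i) + xi i) V fhat ->
  (hk0_variation f <= V%:E)%E ->
  loss x fhat fstar <= loss x f fstar + n%:R^-1 *
    (2 * \sum_i xi i * (fhat (x i) - f (x i)) - \sum_i (fhat (x i) - f (x i)) ^+ 2).
Proof.
move=> n0 [hV hmin] fV.
pose y i := fstar (x i) + xi i.
have ni : 0 < n%:R^-1 :> R by rewrite invr_gt0 ltr0n.
pose A := \sum_i (y i - fhat (x i)) * (f (x i) - fhat (x i)).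
pose B := \sum_i (f (x i) - fhat (x i)) ^+ 2.
have AB t : 0 < t <= 1 -> 2 * A <= t * B.
  move=> /andP[t0 t1].
  have := hmin (convex_comb t fhat f) (hk0_convex (introT andP (conj (ltW t0) t1)) hV fV).
  rewrite /empirical_risk ler_pM2l// -subr_ge0 -sumrB.
  rewrite (eq_bigr (fun i => t * (t * (f (x i) - fhat (x i)) ^+ 2 -
    2 * ((y i - fhat (x i)) * (f (x i) - fhat (x i)))))); last first.
    by move=> i _; rewrite /convex_comb -/(y i); ring.
  by rewrite -mulr_sumr pmulr_rge0// sumrB -!mulr_sumr subr_ge0.
have A0 : A <= 0.
  rewrite leNgt; apply/negP => A0.
  have B1 : 2 * A <= B by rewrite -[B]mul1r AB// ltr01 lexx.
  have B0 : 0 < B by lra.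
  (* At t = A / B the inequality reads 2 A <= A, against A > 0. *)
  have := AB (A / B); rewrite divfK ?gt_eqF//.
  have -> : 0 < A / B <= 1 by rewrite divr_gt0//= ler_pdivrMr// mul1r; lra.
  by move=> /(_ isT); lra.
rewrite /loss -mulrDr ler_pM2l// -subr_ge0.
have -> : \sum_i (f (x i) - fstar (x i)) ^+ 2 +
    (2 * \sum_i xi i * (fhat (x i) - f (x i)) - \sum_i (fhat (x i) - f (x i)) ^+ 2)
    - \sum_i (fhat (x i) - fstar (x i)) ^+ 2 = - (2 * A).
  rewrite /A !mulr_sumr -sumrB -big_split/= -sumrB -sumrN.
  by apply: eq_bigr => i _; rewrite /y; ring.
lra.
Qed.

End hk0_convexity.

(** * The lattice design *)

Section lattice_design.
Variables (R : realType) (n1 n2 : nat).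
Hypothesis n1_gt0 : (0 < n1)%N.
Hypothesis n2_gt0 : (0 < n2)%N.
Local Notation G := ('I_n1 * 'I_n2)%type.

Definition lattice_point (p : G) : R * R :=
  (grid_point R n1 p.1, grid_point R n2 p.2).

Lemma ler_grid_point n i j : (0 < n)%N ->
  (grid_point R n i <= grid_point R n j) = (i <= j)%N.
Proof. by move=> n0; rewrite ler_pM2r ?invr_gt0 ?ltr0n// ler_nat. Qed.

Lemma grid_point_itv n i : (i < n)%N -> 0 <= grid_point R n i <= 1.
Proof.
move=> ni; rewrite /grid_point divr_ge0//= ler_pdivrMr ?ltr0n ?(leq_ltn_trans _ ni)//.
by rewrite mul1r ler_nat ltnW.
Qed.

Lemma lattice_pointE : lattice n1 n2 = range lattice_point.
Proof.
apply/seteqP; split=> [_ [i1 [i2 [h1 h2 ->]]]|_ [p _ <-]].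
  by exists (Ordinal h1, Ordinal h2).
by exists p.1, p.2; split.
Qed.

(** [psi] is injective because [x] is, hence bijective by cardinality. *)
Lemma lattice_enum (x : 'I_(n1 * n2) -> R * R) :
  set_bij setT (lattice n1 n2) x ->
  exists2 psi : 'I_(n1 * n2) -> G, bijective psi & x = lattice_point \o psi.
Proof.
move=> [xf xinj _].
have ex i : exists p, x i = lattice_point p.
  by have := xf i I; rewrite lattice_pointE => -[p _ <-]; exists p.
have [psi psiE] := choice ex.
exists psi; last exact/funext.
apply: inj_card_bij; last by rewrite card_prod !card_ord.
by move=> i j ij; apply: xinj; rewrite ?inE// !psiE ij.
Qed.

Lemma card_lattice_le (S : set (R * R)) (A : pred G) :
  (forall p, S (lattice_point p) -> A p) ->
  (#|` fset_set (lattice n1 n2 `&` S)|)%:R <= \sum_p (A p)%:R :> R.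
Proof.
move=> SA; rewrite -natr_sum ler_nat.
have -> : (\sum_p A p = #|A|)%N.
  rewrite -sum1_card [RHS]big_mkcond; apply: eq_bigr => p _.
  by rewrite unfold_in; case: (A p).
have fin : finite_set (lattice n1 n2 `&` S : set (R * R)).
  apply: finite_setIl; rewrite lattice_pointE.
  exact/finite_image/finite_finset.
have sub : {subset enum_fset (fset_set (lattice n1 n2 `&` S : set (R * R))) <=
    [seq lattice_point p | p <- enum A]}.
  move=> q; rewrite -[_ \in _]/(q \in fset_set _) in_fset_set// inE.
  rewrite lattice_pointE => -[[p _ <-] Sp]; apply: map_f.
  by rewrite mem_enum unfold_in; exact: SA.
have := uniq_leq_size (fset_uniq _) sub.
by rewrite size_map -cardE.
Qed.

(** [k] is the first index whose grid point reaches [t], or [n] if none below [n] does. It turns the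
    real corner of a jump into a grid index. *)
Lemma threshold (n : nat) (t : R) : (0 < n)%N ->
  exists2 k, (k <= n)%N & forall i, (i < n)%N -> (t <= grid_point R n i) = (k <= i)%N.
Proof.
move=> n0.
have ex : exists i, (n <= i)%N || (t <= grid_point R n i) by exists n; rewrite leqnn.
case: (ex_minnP ex) => k Pk kmin; exists k; first by apply: kmin; rewrite leqnn.
move=> i ni; apply/idP/idP => [ti|ki].
  by apply: kmin; rewrite ti orbT.
move: Pk; rewrite leqNgt (leq_ltn_trans ki ni)/= => /le_trans; apply.
by rewrite ler_grid_point.
Qed.

End lattice_design.

(** * Assembly of the risk bound *)

Section monotone_integral.
Context d (T : measurableType d) (R : realType) (mu : {measure set T -> \bar R}).

(* Measurability of [w |-> fhat w] is not assumed; the integral of a nonnegative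
   function is then the supremum over the simple functions below it. *)
Lemma ge0_le_integral_nonmeasurable (f g : T -> \bar R) :
  (forall x, 0 <= f x)%E -> (forall x, f x <= g x)%E ->
  (\int[mu]_x f x <= \int[mu]_x g x)%E.
Proof.
move=> f0 fg; have g0 x : (0 <= g x)%E by exact: le_trans (fg x).
rewrite !ge0_integralTE//; apply: le_ereal_sup => _ [h hf <-].
by exists h => // x; exact: le_trans (fg x).
Qed.

End monotone_integral.

Section rectangle_noise.
Context d (T : measurableType d) (R : realType) (P : probability T R).
Variables (n1 n2 : nat) (sigma : R).
Hypothesis n1_gt0 : (0 < n1)%N.
Hypothesis n2_gt0 : (0 < n2)%N.
Hypothesis sigma_gt0 : 0 < sigma.
Local Notation G := ('I_n1 * 'I_n2)%type.
Variables (I : finType) (psi : I -> G) (xi : I -> {RV P >-> R}).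
Hypothesis psi_bij : bijective psi.
Hypothesis xi_iid : iid_normal sigma xi.

Local Notation rects := (('I_n1.+1 * 'I_n1.+1) * ('I_n2.+1 * 'I_n2.+1))%type.

(** This is the square root of the number of cells, the standard deviation of the noise on the
    rectangle in units of [sigma]. *)
Let area (k : rects) : R :=
  rootn R (k.1.2 - k.1.1) * rootn R (k.2.2 - k.2.1).

(* For a rectangle without points [area k = 0], and the division gives 0. *)
Let weight (k : rects) (i : I) : R :=
  (in_rect k.1.1 k.1.2 k.2.1 k.2.2 (psi i))%:R / (sigma * area k).

Let weight_le1 k : sigma ^+ 2 * \sum_i weight k i ^+ 2 <= 1.
Proof.
have area2 : area k ^+ 2 = \sum_(p : G) (in_rect k.1.1 k.1.2 k.2.1 k.2.2 p)%:R.
  have := @sum_rect R n1 n2 (fun=> 1) (fun=> 1) k.1.1 k.1.2 k.2.1 k.2.2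
    (ltn_ord k.1.2) (ltn_ord k.2.2).
  rewrite !sumr_const_nat exprMn !sqr_sqrtr// => <-.
  by apply: eq_bigr => p _; rewrite !mul1r.
have -> : \sum_i weight k i ^+ 2 = area k ^+ 2 / (sigma * area k) ^+ 2.
  rewrite area2 (reindex psi) /=; last exact: onW_bij.
  rewrite mulr_suml; apply: eq_bigr => i _; rewrite /weight exprMn exprVn.
  by congr (_ / _); case: (in_rect _ _ _ _ _); rewrite ?expr1n ?expr2 ?mul0r.
have [->|a0] := eqVneq (area k) 0; first by rewrite expr0n/= mul0r mulr0.
move: (area k) a0 => e e0.
rewrite (_ : _ * (_ / _) = 1)//; field.
by rewrite e0 gt_eqF.
Qed.

Lemma gaussian_rect : exists Gm : T -> R,
  [/\ measurable_fun setT Gm, forall w, 0 <= Gm w,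
    forall w a1 b1 a2 b2, (b1 <= n1)%N -> (b2 <= n2)%N ->
      `|\sum_i xi i w * (in_rect a1 b1 a2 b2 (psi i))%:R| <=
      sigma * Num.sqrt (Gm w) * (rootn R (b1 - a1) * rootn R (b2 - a2)) &
    (\int[P]_w (Gm w)%:E <= (34 * (1 + ln (n1 * n2)%:R))%:E)%E].
Proof.
pose N := #|{: rects}|; have NE : N = (n1.+1 * n1.+1 * (n2.+1 * n2.+1))%N.
  by rewrite /N !card_prod !card_ord.
have N0 : (0 < N)%N by rewrite NE.
have lN : 0 <= ln N%:R :> R by rewrite ln_ge0// ler1n.
pose a : R := Num.sqrt (2 * ln N%:R + 1).
(* This [a] makes N exp (- a^2 / 2) at most 1, leaving an expectation of at most 2 a^2 + 8 = 4 ln N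
   + 10. *)
have a2 : a ^+ 2 = 2 * ln N%:R + 1 by rewrite sqr_sqrtr//; lra.
have a1 : 1 <= a by rewrite -[leLHS]sqrtr1 ler_sqrt//; lra.
have [Gm [mG G0 Gmax EG]] := gaussian_max sigma_gt0 xi_iid a1 weight_le1.
exists Gm; split => // [w r1 s1 r2 s2 h1 h2|].
  have rect0 : (forall p : G, in_rect r1 s1 r2 s2 p = false) ->
      `|\sum_i xi i w * (in_rect r1 s1 r2 s2 (psi i))%:R| <=
      sigma * Num.sqrt (Gm w) * (rootn R (s1 - r1) * rootn R (s2 - r2)).
    move=> h; rewrite big1 ?normr0 => [|i _]; last by rewrite h mulr0.
    by rewrite !mulr_ge0 ?rootn_ge0 ?sqrtr_ge0 ?(ltW sigma_gt0).
  have [rs1|rs1] := leqP s1 r1.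
    apply: rect0 => p; rewrite /in_rect.
    by have [/leq_trans/(_ rs1)|] := ltnP p.1 s1; rewrite ?andbF// ltnNge => /negbTE ->.
  have [rs2|rs2] := leqP s2 r2.
    apply: rect0 => p; rewrite /in_rect.
    have [/leq_trans/(_ rs2)|] := ltnP p.2 s2; rewrite ?andbF//.
    by rewrite (ltnNge _ r2) => /negbTE ->; rewrite andbF.
  have r1n : (r1 < n1.+1)%N by rewrite (leq_trans rs1)// leqW.
  have r2n : (r2 < n2.+1)%N by rewrite (leq_trans rs2)// leqW.
  pose k : rects := ((Ordinal r1n, Ordinal (h1 : (s1 < n1.+1)%N)),
                     (Ordinal r2n, Ordinal (h2 : (s2 < n2.+1)%N))).
  have area0 : 0 < sigma * area k.
    by rewrite !mulr_gt0// sqrtr_gt0 ltr0n subn_gt0.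
  have -> : \sum_i xi i w * (in_rect r1 s1 r2 s2 (psi i))%:R =
      sigma * area k * \sum_i weight k i * xi i w.
    rewrite mulr_sumr; apply: eq_bigr => i _; rewrite /weight.
    by field; rewrite !gt_eqF//; move: area0; rewrite pmulr_rgt0.
  rewrite normrM (gtr0_norm area0).
  rewrite (_ : _ * (_ * rootn _ _) = sigma * area k * Num.sqrt (Gm w)); last first.
    by rewrite /area/=; ring.
  by rewrite ler_pM2l// -sqrtr_sqr ler_wsqrtr.
apply: le_trans EG _; rewrite lee_fin -/N a2.
have eN : N%:R * expR (- ((2 * ln N%:R + 1) / 2)) <= 1 :> R.
  rewrite -{1}[N%:R]lnK ?posrE ?ltr0n// -expRD -[leRHS]expR0 ler_expR; lra.
have ln4 : ln 4 <= 3 :> R.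
  by have := @le_ln1Dx R 3; rewrite (_ : 1 + 3 = 4); [apply; lra|lra].
(* N <= (4 n1 n2)^2 and ln 4 <= 3; then 4 ln N + 10 <= 34 + 8 ln (n1 n2). *)
have lNn : ln N%:R <= 6 + 2 * ln (n1 * n2)%:R :> R.
  have n0 : (0 : R) < (n1 * n2)%:R by rewrite ltr0n muln_gt0 n1_gt0.
  have : ln N%:R <= ln ((4 * (n1 * n2)%:R) ^+ 2) :> R.
    rewrite ler_ln ?posrE ?ltr0n ?exprn_gt0 ?mulr_gt0//.
    rewrite -natrM -natrX ler_nat NE.
    have m1 : (n1.+1 <= 2 * n1)%N by lia.
    have m2 : (n2.+1 <= 2 * n2)%N by lia.
    have -> : ((4 * (n1 * n2)) ^ 2 = (2 * n1) * (2 * n1) * ((2 * n2) * (2 * n2)))%N by lia.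
    by rewrite !leq_mul.
  rewrite lnXn ?mulr_gt0// lnM ?posrE//; lra.
have : 0 <= ln (n1 * n2)%:R :> R by rewrite ln_ge0// ler1n muln_gt0 n1_gt0.
lra.
Qed.

End rectangle_noise.

Lemma jump_noise_bound (R : realType) (n1 n2 : nat) (c Q L V : R)
    (x : 'I_(n1 * n2) -> R * R) (psi : 'I_(n1 * n2) -> 'I_n1 * 'I_n2)
    (z : 'I_(n1 * n2) -> R) (fhat f : R * R -> R) :
  (0 < n1)%N -> (0 < n2)%N -> 0 < c -> c <= 1 -> 0 <= Q ->
  1 + ln n1%:R <= L -> 1 + ln n2%:R <= L ->
  bijective psi -> x = lattice_point R (n2 := n2) \o psi ->
  (forall a1 b1 a2 b2, (b1 <= n1)%N -> (b2 <= n2)%N ->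
    `|\sum_i z i * (in_rect a1 b1 a2 b2 (psi i))%:R| <=
    Q * (rootn R (b1 - a1) * rootn R (b2 - a2))) ->
  one_jump n1 n2 c f -> hk0_variation f = V%:E -> (hk0_variation fhat <= V%:E)%E ->
  2 * \sum_i z i * (fhat (x i) - f (x i)) - \sum_i (fhat (x i) - f (x i)) ^+ 2 <=
  17000 / c ^+ 3 * (Q * L) ^+ 2.
Proof.
move=> n1_gt0 n2_gt0 c0 c1 Q0 L1 L2 psi_bij xE z_rect.
move=> [a1 [a0 [xs [xs_box cmin fE]]]] fV fhatV.
(* The budget of [fhat] is the variation of [f], hence at most the jump height: this places
   [fhat - f] in the cone. *)
have Va1 : V <= `|a1| by rewrite -lee_fin -fV; exact: one_jump_hk0 xs_box fE.
have [k1 k1n k1P] := threshold xs.1 n1_gt0.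
have [k2 k2n k2P] := threshold xs.2 n2_gt0.
have pt_box (p : 'I_n1 * 'I_n2) : box (0, 0) (1, 1) (lattice_point R p).
  by split; rewrite /= in_itv/=; apply: grid_point_itv.
have stepE (p : 'I_n1 * 'I_n2) :
    step xs.1 (lattice_point R p).1 * step xs.2 (lattice_point R p).2 =
    (grid_le k1 k2 p)%:R.
  by rewrite /step k1P// k2P// -natrM mulnb.
have inbox (p : 'I_n1 * 'I_n2) : box xs (1, 1) (lattice_point R p) <-> grid_le k1 k2 p.
  have [/=] := pt_box p; rewrite !in_itv/= => /andP[_ p1] /andP[_ p2].
  rewrite /box /grid_le /= -(k1P _ (ltn_ord p.1)) -(k2P _ (ltn_ord p.2)).
  rewrite !in_itv/= p1 p2 !andbT.
  by split=> [[-> ->//]|/andP[]].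
have card_in : c * (n1%:R * n2%:R) <= \sum_(i : 'I_n1 * 'I_n2) (grid_le k1 k2 i)%:R.
  rewrite -natrM; apply: le_trans cmin _.
  apply: le_trans (_ : _ <= #|` fset_set (lattice n1 n2 `&` box xs (1, 1))|%:R) _.
    by rewrite ler_nat geq_minl.
  by apply: card_lattice_le => p /inbox.
have card_out : c * (n1%:R * n2%:R) <= \sum_(i : 'I_n1 * 'I_n2) (~~ grid_le k1 k2 i)%:R.
  rewrite -natrM; apply: le_trans cmin _.
  apply: le_trans (_ : _ <= #|` fset_set (lattice n1 n2 `\` box xs (1, 1))|%:R) _.
    by rewrite ler_nat geq_minr.
  rewrite setDE; apply: (card_lattice_le (A := fun p => ~~ grid_le k1 k2 p)) => p /= np.
  by apply/negP => /inbox.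
(* Multiplying both the noise and [fhat - f] by the sign of the jump changes neither sum and makes
   the height [|a1|]. *)
have [s s2 sa1] : exists2 s : R, s ^+ 2 = 1 & s * a1 = `|a1|.
  have [h|h] := leP 0 a1; first by exists 1; rewrite ?expr1n ?mul1r ?ger0_norm.
  by exists (-1); rewrite ?sqrrN ?expr1n// mulN1r ltr0_norm.
have sn : `|s| = 1.
  by apply/eqP; rewrite -(@eqrXn2 _ 2)// real_normK ?num_real// s2 expr1n.
pose be (p : 'I_n1 * 'I_n2) := mixed_diff n1 n2 fhat p.1 p.2.
pose o : 'I_n1 * 'I_n2 := (Ordinal n1_gt0, Ordinal n2_gt0).
(* The origin carries the value of [fhat] and no variation; it enters [b] instead. *)
pose gam (p : 'I_n1 * 'I_n2) := if (0 < p.1 + p.2)%N then s * be p else 0.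
pose b := s * (be o - a0).
have gam_le : \sum_p `|gam p| <= `|a1|.
  apply: le_trans Va1; apply: le_trans (mixed_diff_le_hk0 n1_gt0 n2_gt0 fhatV).
  rewrite [leRHS]big_mkcond/=; apply: ler_sum => p _; rewrite /gam.
  by case: ifP => _; rewrite ?normr0// normrM sn mul1r.
have [phi psiK phiK] := psi_bij.
have uE (p : 'I_n1 * 'I_n2) :
    cone_fun k1 k2 gam `|a1| b p.1 p.2 =
    s * (fhat (lattice_point R p) - f (lattice_point R p)).
  rewrite (one_jumpE fE (pt_box p)) stepE /lattice_point -sum_mixed_diff.
  rewrite /cone_fun -/(grid_le k1 k2 p) (bigD1 o)//= [X in s * (X - _)](bigD1 o)//=.
  rewrite /gam /= mul0r add0r mulr1 -sa1 /b -/(be o).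
  set S1 := \sum_(_ | _) _; set S2 := \sum_(_ | _) _.
  suff -> : S1 = s * S2 by rewrite /be /mixed_diff/=; ring.
  rewrite /S1 /S2 mulr_sumr; apply: eq_bigr => j jo.
  have -> : (0 < j.1 + j.2)%N.
    rewrite lt0n addn_eq0; apply: contra jo => /andP[j1 j2].
    by apply/eqP; case: j j1 j2 => j1 j2 /= /eqP h1 /eqP h2; congr pair; apply: val_inj.
  by rewrite mulrA.
have := @noise_tangent_bound R n1 n2 k1 k2 Q L n1_gt0 n2_gt0 Q0 L1 L2
  (fun p => s * z (phi p)) _ k1n k2n gam `|a1| gam_le b c c0 c1 card_in card_out.
rewrite (reindex psi) /=; last exact: onW_bij.
rewrite [X in _ - X](reindex psi) /=; last exact: onW_bij.
have -> : \sum_i s * z (phi (psi i)) * cone_fun k1 k2 gam `|a1| b (psi i).1 (psi i).2 =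
    \sum_i z i * (fhat (x i) - f (x i)).
  apply: eq_bigr => i _; rewrite psiK uE xE /= mulrACA -expr2 s2 mul1r.
  by [].
have -> : \sum_i cone_fun k1 k2 gam `|a1| b (psi i).1 (psi i).2 ^+ 2 =
    \sum_i (fhat (x i) - f (x i)) ^+ 2.
  by apply: eq_bigr => i _; rewrite uE xE /= exprMn s2 mul1r.
apply=> r1 s1 r2 q2 h1 h2; rewrite (reindex psi) /=; last exact: onW_bij.
under eq_bigr do rewrite psiK -mulrA.
by rewrite -mulr_sumr normrM sn mul1r; exact: z_rect.
Qed.

(** ln (e n) = 1 + ln n >= 1, so the iterated logarithm factor is at least 1. *)
Lemma log_factor_ge (R : realType) n : (0 < n)%N ->
  (1 + ln n%:R) ^+ 3 <= log_factor n :> R.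
Proof.
move=> n0; rewrite /log_factor.
have ne : (0 : R) < n%:R by rewrite ltr0n.
have l0 : 0 <= ln n%:R :> R by rewrite ln_ge0// ler1n.
rewrite lnM ?posrE ?expR_gt0// expRK.
have l1 : 0 < 1 + ln n%:R :> R by lra.
rewrite lnM ?posrE ?expR_gt0// expRK.
have l2 : 0 <= ln (1 + ln n%:R) :> R by rewrite ln_ge0//; lra.
have l3 : 0 < 1 + ln (1 + ln n%:R) :> R by lra.
rewrite ler_peMr ?exprn_ge0 ?(ltW l1)//.
rewrite /powR gt_eqF// -[leLHS]expR0 ler_expR mulr_ge0 ?divr_ge0// ln_ge0//.
by lra.
Qed.

Theorem theorem6p1 (R : realType) (c : R) (c_gt0 : 0 < c) (c_le : c <= 1 / 2) :
  exists C : R,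
  forall (n1 n2 : nat) (n1_ge1 : (1 <= n1)%N) (n2_ge1 : (1 <= n2)%N)
    (x : 'I_(n1 * n2) -> R * R) (x_enum : set_bij setT (lattice n1 n2) x)
    (sigma : R) (sigma_gt0 : 0 < sigma)
    (fstar : R * R -> R)
    (d : measure_display) (T : measurableType d) (P : probability T R)
    (xi : 'I_(n1 * n2) -> {RV P >-> R}) (xi_iid : iid_normal sigma xi)
    (V : R) (V_gt0 : 0 < V)
    (fhat : T -> R * R -> R)
    (fhat_lse : forall w : T,
      hk0_lse x (fun i => fstar (x i) + xi i w) V (fhat w)),
  ('E_P[fun w => loss x (fhat w) fstar] <=
   ereal_inf [set (loss x f fstar +
       C * (sigma ^+ 2 / (n1 * n2)%:R) * log_factor (n1 * n2))%:E |
     f in one_jump n1 n2 c `&` [set f | hk0_variation f = V%:E]])%E.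
Proof.
have c_le1 : c <= 1 by lra.
(* The first factor comes from [noise_tangent_bound], the 34 from [gaussian_rect]. *)
exists (17000 / c ^+ 3 * 34).
move=> n1 n2 n1_gt0 n2_gt0 x x_enum sigma sigma_gt0 fstar d T P xi xi_iid V V_gt0
  fhat fhat_lse.
set n := (n1 * n2)%N.
have n_gt0 : (0 < n)%N by rewrite muln_gt0 n1_gt0.
have nr : (0 : R) < n%:R by rewrite ltr0n.
have [psi psi_bij xE] := lattice_enum x_enum.
have [Gm [mG G0 G_rect EG]] := gaussian_rect n1_gt0 n2_gt0 sigma_gt0 psi_bij xi_iid.
have [L LE] : exists L : R, L = 1 + ln n%:R by eexists.
have [K KE] : exists K : R, K = 17000 / c ^+ 3 by eexists.
have K0 : 0 <= K by rewrite KE divr_ge0 ?ler0n// exprn_ge0// ltW.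
have L0 : 0 <= L by rewrite LE addr_ge0// ln_ge0// ler1n.
have lnL m : (0 < m)%N -> (m <= n)%N -> 1 + ln m%:R <= L.
  by move=> m0 mn; rewrite LE lerD2l ler_ln ?posrE ?ltr0n// ler_nat.
have L1 : 1 + ln n1%:R <= L by apply: lnL => //; rewrite leq_pmulr.
have L2 : 1 + ln n2%:R <= L by apply: lnL => //; rewrite leq_pmull.
apply: le_ereal_inf_tmp => _ [f [f_jump fV] <-].
have {}fV : hk0_variation f = V%:E := fV.
have fV_le : (hk0_variation f <= V%:E)%E by rewrite fV.
have [A AE] : exists A, A = loss x f fstar by eexists.
have [B BE] : exists B, B = n%:R^-1 * (K * sigma ^+ 2 * L ^+ 2) by eexists.
have B0 : 0 <= B by rewrite BE mulr_ge0 ?invr_ge0// mulr_ge0 ?sqr_ge0// mulr_ge0 ?sqr_ge0.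
have loss_ge0 g h : 0 <= loss x g h.
  by rewrite mulr_ge0 ?invr_ge0// sumr_ge0// => i _; exact: sqr_ge0.
have A0 : 0 <= A by rewrite AE.
(* The random noise level [sigma * Num.sqrt (Gm w)] is valid for every [w], so no exceptional event
   is split off; its square is linear in [Gm w] and integrates directly. *)
have pathwise w : loss x (fhat w) fstar <= A + B * Gm w.
  apply: le_trans (hk0_lse_loss n_gt0 (fhat_lse w) fV_le) _.
  rewrite AE lerD2l BE -mulrA ler_pM2l ?invr_gt0//.
  have := @jump_noise_bound R n1 n2 c (sigma * Num.sqrt (Gm w)) L V x psi
    (fun i => xi i w) (fhat w) f n1_gt0 n2_gt0 c_gt0 c_le1 _ L1 L2 psi_bij xE
    (G_rect w) f_jump fV (fhat_lse w).1.
  rewrite -KE !exprMn sqr_sqrtr//.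
  rewrite mulr_ge0 ?sqrtr_ge0 ?(ltW sigma_gt0)// => /(_ isT) h.
  by apply: le_trans h _; rewrite le_eqVlt; apply/orP; left; apply/eqP; ring.
rewrite unlock; apply: (@le_trans _ _ (\int[P]_w (A + B * Gm w)%:E)%E).
  by apply: ge0_le_integral_nonmeasurable => w; rewrite lee_fin.
under eq_integral do rewrite EFinD EFinM.
rewrite ge0_integralD//; first last.
- by apply/measurable_EFinP; apply: measurable_funM.
- by move=> w _; rewrite -EFinM lee_fin mulr_ge0.
rewrite integral_cst//= probability_setT mule1 ge0_integralZl//; first last.
- by move=> w _; rewrite lee_fin.
- exact/measurable_EFinP.
apply: le_trans (leeD (lexx _) (lee_wpmul2l _ EG)) _; first by rewrite lee_fin.
rewrite -EFinM -EFinD lee_fin -AE lerD2l -/n -LE -KE.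
(* Two factors [L] come from the weights and one from the expected maximum. *)
have -> : B * (34 * L) = K * 34 * (sigma ^+ 2 / n%:R) * L ^+ 3 by rewrite BE; ring.
apply: ler_wpM2l; last by rewrite LE log_factor_ge.
by apply: mulr_ge0; [rewrite mulr_ge0 ?ler0n|rewrite divr_ge0 ?sqr_ge0 ?ler0n].
Qed.
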